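(* For integers $n>1$ define $b(n)$ by \[ K_n=b(n)\sqrt{\frac{\log n}{n}} , \] where $K_n$ is the $n$-dimensional Bohr radius. Then \[ b(n)\ge \frac{1}{\sqrt{2}}+o(1)\qquad\text{when } n\to\infty , \] that is, $\liminf_{n\to\infty} b(n)\ge \frac{1}{\sqrt 2}$.
   Context: $\mathbb{D}^n=\{z\in\mathbb{C}^n: |z_k|<1,\ k=1,\dots,n\}$ is the open unit polydisc and $r\mathbb{D}^n=\{rz: z\in\mathbb{D}^n\}$. For multi-indices $\alpha=(\alpha_1,\dots,\alpha_n)$ of non-negative integers, $z^\alpha=z_1^{\alpha_1}\cdots z_n^{\alpha_n}$. The $n$-dimensional Bohr radius $K_n$ is the largest positive number $r$ such that all polynomials $\sum_\alpha a_\alpha z^\alpha$ in $n$ complex variables (with complex coefficients, of arbitrary degree, not necessarily homogeneous) satisfy \[ \sup_{z\in r\mathbb{D}^n}\sum_\alpha |a_\alpha z^\alpha| \le \sup_{z\in\mathbb{D}^n}\Bigl|\sum_\alpha a_\alpha z^\alpha\Bigr| . \] *)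

(* Defs.v *)
From HB Require Import structures.
From mathcomp Require Import all_boot all_order all_algebra.
From mathcomp Require Import all_classical all_reals all_analysis.
From mathcomp Require Import complex.
(* Only the coercions and canonical structures of mpoly are imported: its
   notations clash with those of mathcomp-analysis. *)
From mathcomp Require mpoly.
Export (coercions, canonicals) mpoly.

Set Implicit Arguments.
Unset Strict Implicit.
Unset Printing Implicit Defensive.
Import Order.TTheory GRing.Theory Num.Theory.
Local Open Scope classical_set_scope.
Local Open Scope ring_scope.
Local Open Scope complex_scope.

Definition polydisc (R : realType) (n : nat) : set ('I_n -> R[i]) :=
  [set z | forall k, Normc.normc (z k) < 1].
Arguments polydisc : clear implicits.

Definition scaled_polydisc (R : realType) (n : nat) (r : R) :
    set ('I_n -> R[i]) :=
  (fun z k => r%:C * z k) @` polydisc R n.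
Arguments scaled_polydisc {R} n r.

Definition majorant (R : realType) (n : nat) (p : mpoly.mpoly n R[i])
    (z : 'I_n -> R[i]) : R :=
  \sum_(m <- mpoly.msupp p)
    Normc.normc (mpoly.mcoeff m p * \prod_(k < n) z k ^+ m k).

(* Suprema are taken in \bar R, so that no boundedness side condition is
   hidden in a default value. *)
Definition bohr_inequality (R : realType) (n : nat) (r : R) : Prop :=
  forall p : mpoly.mpoly n R[i],
    (ereal_sup [set (majorant p z)%:E | z in scaled_polydisc n r] <=
     ereal_sup [set (Normc.normc (mpoly.meval z p))%:E | z in polydisc R n])%E.

Definition is_bohr_radius (R : realType) (n : nat) (r : R) : Prop :=
  [/\ 0 < r, bohr_inequality n r &
      forall s : R, 0 < s -> bohr_inequality n s -> s <= r].

(* The largest r > 0 satisfying the inequality; the default value 0 would be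
   taken only if there were no largest one. *)
Definition bohr_radius (R : realType) (n : nat) : R :=
  xget 0 [set r : R | is_bohr_radius n r].

(* Main.v *)
Require Import Defs.
From HB Require Import structures.
From mathcomp Require Import all_boot all_order all_algebra.
From mathcomp Require Import complex ring lra.
From mathcomp Require mpoly.
(** Write [P_d] for the homogeneous part of degree [d] of a polynomial [p] with
    [|p| <= M] on the polydisc.  Caratheodory's inequality gives
    [|P_d| <= 2 (M - |p(0)|)], so it suffices that [sum_d r^d A_d <= 1/2], where
    [A_d] bounds the sum of the moduli of the coefficients of a [d]-homogeneous
    polynomial of sup norm 1.  The point is to gain a factor [n^(-1/2)] over the
    Cauchy-Schwarz bound for [A_d] while losing only [sqrt 2 ^ d].  By Cauchy's
    estimates the Hessian [d_i d_j P_d (z)] is, for each [z], the matrix of a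
    bilinear form bounded by [e^2 d^2], so Littlewood's 4/3 inequality applies to
    its entries.  Averaging over [z] in the torus, and passing from [L^(4/3)] to
    [L^2] entry by entry, costs [sqrt 2 ^ d]: this follows by interpolation
    from [|q|_4 <= sqrt 2 ^ d |q|_2], which is Cauchy-Schwarz together with the
    fact that a monomial of degree [2 d] has at most [4 ^ d] divisors.  Two
    derivatives, rather than the full multilinear form of the
    Bohnenblust-Hille inequality, are thus enough.  Torus integrals are replaced
    throughout by averages over roots of unity of large order, which are exact
    on polynomials. *)
Set Implicit Arguments.
Unset Strict Implicit.
Unset Printing Implicit Defensive.
Import Order.TTheory GRing.Theory Num.Theory.
Local Open Scope ring_scope.

(** * Roots of unity and their orthogonality *)

Section RootsOfUnity.
Variable C : numClosedFieldType.

(** Iterated square roots starting from -1 give [w] with [w ^+ (2 ^ K) = -1]. Its order divides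
    [2 ^ K.+1] but not [2 ^ K], so it is exactly [2 ^ K.+1], which exceeds [K]. *)
Lemma exists_large_prim_root (K : nat) :
  exists N (w : C), (K < N)%N /\ N.-primitive_root w.
Proof.
have [w hw] : exists w : C, w ^+ (2 ^ K) = -1.
  elim: K => [|K [w hw]]; first by exists (-1); rewrite expn0 expr1.
  by exists (sqrtC w); rewrite expnS exprM sqrtCK.
have w1 : w ^+ (2 ^ K.+1) = 1 by rewrite expnSr exprM hw sqrrN expr1n.
have [|m hm /dvdn_pfactor] := prim_order_exists _ w1; first by rewrite expn_gt0.
case=> // j; rewrite leq_eqVlt => /orP[/eqP ej|ltj] mE.
  exists m, w; split=> //; rewrite mE ej.
  by apply: (leq_trans (ltn_expl K (isT : 1 < 2)%N)); rewrite leq_exp2l.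
have : w ^+ (2 ^ K) = 1.
  rewrite -(subnK (ltj : (j <= K)%N)) expnD mulnC exprM -mE.
  by rewrite (prim_expr_order hm) expr1n.
by move=> /eqP; rewrite hw eq_sym -addr_eq0 -mulr2n pnatr_eq0.
Qed.

Variables (N : nat) (w : C).
Hypothesis wP : N.-primitive_root w.

Lemma prim_root_norm : `|w| = 1.
Proof.
apply/eqP; rewrite -(@pexpr_eq1 _ `|w| N) ?(prim_order_gt0 wP) //.
by rewrite -normrX (prim_expr_order wP) normr1.
Qed.

Lemma prim_root_orthogonality (a b : nat) :
  \sum_(j < N) w ^+ (j * a) * (w ^+ (j * b))^* = N%:R * (a == b %[mod N])%:R.
Proof.
have nX k : `|w ^+ k| = 1 by rewrite normrX prim_root_norm expr1n.
have cX k : w ^+ k * (w ^+ k)^* = 1 by rewrite -normCK nX expr1n.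
set u := w ^+ a * (w ^+ b)^*.
have uE (j : 'I_N) : w ^+ (j * a) * (w ^+ (j * b))^* = u ^+ j.
  by rewrite !(mulnC j) !exprM rmorphXn /= -exprMn.
under eq_bigr do rewrite uE.
have -> : (a == b %[mod N]) = (u == 1).
  rewrite -(eq_prim_root_expr wP) -(cX b) /u.
  rewrite (can_eq (mulfK _)) // conjC_eq0 -normr_eq0 nX oner_eq0 //.
have uN : u ^+ N - 1 = 0.
  apply/eqP; rewrite subr_eq0 exprMn -rmorphXn /= -!exprM !(mulnC _ N) !exprM.
  by rewrite (prim_expr_order wP) !expr1n rmorph1 mulr1.
move: uN; rewrite subrX1; case: eqVneq => [-> _|un].
  by rewrite (eq_bigr (fun=> 1)) ?mulr1 ?sumr_const ?card_ord // => i _; rewrite expr1n.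
by move/eqP; rewrite mulf_eq0 subr_eq0 (negPf un) /= => /eqP ->; rewrite mulr0.
Qed.

Definition torus_point (n : nat) (x : {ffun 'I_n -> 'I_N}) : 'I_n -> C :=
  fun k => w ^+ x k.

Lemma torus_point_norm n (x : {ffun 'I_n -> 'I_N}) k : `|torus_point x k| = 1.
Proof. by rewrite normrX prim_root_norm expr1n. Qed.

End RootsOfUnity.

(** Cauchy-Schwarz against the constant 1, by summing [2 x y <= x ^ 2 + y ^ 2] over all pairs. The
    generality of [R] lets it serve both for complex moduli and over the reals. *)
Lemma sqr_sum_le_size (R : numDomainType) (T : Type) (s : seq T) (f : T -> R) :
  (forall t, 0 <= f t) ->
  (\sum_(t <- s) f t) ^+ 2 <= (size s)%:R * \sum_(t <- s) f t ^+ 2.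
Proof.
move=> f0; rewrite -(ler_pMn2r (isT : (0 < 2)%N)).
have -> : (\sum_(t <- s) f t) ^+ 2 *+ 2 = \sum_(t <- s) \sum_(u <- s) (f t * f u) *+ 2.
  rewrite expr2 mulr_suml -sumrMnl; apply: eq_bigr => t _.
  by rewrite mulr_sumr -sumrMnl.
have -> : (size s)%:R * (\sum_(t <- s) f t ^+ 2) *+ 2 =
    \sum_(t <- s) \sum_(u <- s) (f t ^+ 2 + f u ^+ 2).
  under [RHS]eq_bigr do rewrite big_split /= big_const_seq count_predT iter_addr_0.
  by rewrite big_split /= big_const_seq count_predT iter_addr_0 sumrMnl mulr_natl mulr2n.
apply: ler_sum => t _; apply: ler_sum => u _; rewrite -subr_ge0 addrAC -sqrrB.
by rewrite real_exprn_even_ge0 // realB // ger0_real.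
Qed.

(** * Means over the torus: Parseval and the fourth moment *)

Section TorusMeans.
Import mpoly.
Variables (C : numClosedFieldType) (n : nat).
Implicit Types (p q : {mpoly C[n]}) (m : 'X_{1..n}).

Definition coef_sqsum p : C := \sum_(m <- msupp p) `|p@_m| ^+ 2.

Lemma mnm_le_mdeg m k : (m k <= mdeg m)%N.
Proof. by rewrite mdegE (bigD1 k) //= leq_addr. Qed.

Section PrimRoot.
Variables (N : nat) (w : C).
Hypothesis wP : N.-primitive_root w.

(** The sum over the grid factors into one sum per coordinate, and for exponents below [N]
    congruence modulo [N] is equality, so no aliasing occurs. *)
Lemma monomial_orthogonality m m' : (mdeg m < N)%N -> (mdeg m' < N)%N ->
  \sum_(x : {ffun 'I_n -> 'I_N})
     'X_[m].@[torus_point w x] * ('X_[m'].@[torus_point w x])^* =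
  N%:R ^+ n * (m == m')%:R.
Proof.
move=> hm hm'.
under eq_bigr => x _ do rewrite !mevalX rmorph_prod -big_split /=.
under eq_bigr => x _.
  under eq_bigr => k _ do rewrite rmorphXn /= -exprM -rmorphXn -exprM /=.
  over.
rewrite -(bigA_distr_bigA (fun k (j : 'I_N) => w ^+ (j * m k) * (w ^+ (j * m' k))^*)) /=.
under eq_bigr do rewrite (prim_root_orthogonality wP) !modn_small ?(leq_ltn_trans (mnm_le_mdeg _ _)) //.
rewrite big_split /= prodr_const card_ord; congr (_ * _).
have [->|/eqP ne] := eqVneq m m'; first by rewrite big1 // => i _; rewrite eqxx.
case: (pickP (fun k => m k != m' k)) => [k hk|h]; last first.
  by case: ne; apply/mnmP => k; apply/eqP/negbFE/h.
by rewrite (bigD1 k) //= (negPf hk) mul0r.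
Qed.

Lemma parseval_torus p : (msize p <= N)%N ->
  \sum_(x : {ffun 'I_n -> 'I_N}) `|p.@[torus_point w x]| ^+ 2 =
  N%:R ^+ n * coef_sqsum p.
Proof.
move=> pN.
have E x : `|p.@[torus_point w x]| ^+ 2 =
  \sum_(m <- msupp p) \sum_(m' <- msupp p) p@_m * (p@_m')^* *
    ('X_[m].@[torus_point w x] * ('X_[m'].@[torus_point w x])^*).
  rewrite normCK {1 2}[p]mpolyE raddf_sum rmorph_sum mulr_suml /=.
  apply: eq_bigr => m _; rewrite mulr_sumr; apply: eq_bigr => m' _.
  by rewrite !mevalZ rmorphM /= mulrACA.
under eq_bigr do rewrite E.
rewrite exchange_big mulr_sumr big_seq_cond [RHS]big_seq_cond.
apply: eq_bigr => m; rewrite andbT => hm.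
rewrite exchange_big /= (bigD1_seq m) //=.
rewrite [X in _ + X]big_seq_cond [X in _ + X]big1 ?addr0; last first.
  move=> m' /andP[hm' ne]; rewrite -mulr_sumr.
  rewrite monomial_orthogonality ?(leq_trans _ pN) ?msize_mdeg_lt //.
  by rewrite eq_sym (negPf ne) !mulr0.
rewrite -mulr_sumr monomial_orthogonality ?(leq_trans _ pN) ?msize_mdeg_lt //.
by rewrite eqxx mulr1 -normCK mulrC.
Qed.

End PrimRoot.

(** The number of divisors of [g] is the product of the [g k + 1], and [g k + 1 <= 2 ^ g k]. *)
Lemma size_mnm_le (g : 'X_{1..n}) (s : seq 'X_{1..n}) :
  uniq s -> all (fun m => lem m g) s -> (size s <= 2 ^ mdeg g)%N.
Proof.
move=> us /allP sg.
pose T := {ffun 'I_n -> 'I_(mdeg g).+1}.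
pose F (m : 'X_{1..n}) : T := [ffun k => inord (m k)].
have Fv m k : m \in s -> (F m k : nat) = m k.
  move=> ms; rewrite ffunE inordK // ltnS.
  by apply: leq_trans (mnm_le_mdeg g k); have /mnm_lepP := sg m ms; apply.
pose fam := family (fun k (j : 'I_(mdeg g).+1) => (j <= g k)%N).
have -> : size s = size [seq F m | m <- s] by rewrite size_map.
apply: (@leq_trans #|fam|).
  rewrite cardE; apply: uniq_leq_size.
    rewrite map_inj_in_uniq // => a b sa sb E; apply/mnmP => k.
    by rewrite -(Fv a) // -(Fv b) // E.
  move=> _ /mapP[m ms ->]; rewrite mem_enum; apply/familyP => k.
  by rewrite unfold_in Fv //; have /mnm_lepP := sg m ms; apply.
rewrite card_family.
have cF k : (#|(fun j : 'I_(mdeg g).+1 => (j <= g k)%N)| <= 2 ^ g k)%N.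
  apply: leq_trans (ltn_expl (g k) (isT : (1 < 2)%N)).
  rewrite cardE -(size_map val) -[leqRHS](size_iota 0); apply: uniq_leq_size.
    by rewrite (map_inj_uniq val_inj) enum_uniq.
  by move=> _ /mapP[j + ->]; rewrite mem_enum mem_iota add0n ltnS.
rewrite foldrE big_map big_enum /= [in leqRHS]mdegE.
by apply: (big_ind2 (fun a b => a <= 2 ^ b)%N) => // a b c d ab cd; rewrite expnD leq_mul.
Qed.

Lemma msize_dhomog d p : p \is d.-homog -> (msize p <= d.+1)%N.
Proof.
move=> /dhomogP hp; rewrite msizeE big_seq_cond.
by apply/bigmax_leqP_seq => m hm _; rewrite ltnS -(hp m) //; move: hm => /=.
Qed.

(** A coefficient of [p * q] at [g] is a sum over factorizations of [g]. There are at most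
    [2 ^ (d + d)] of them, since the first factor divides [g], so Cauchy-Schwarz costs that
    factor. *)
Lemma coef_sqsumM_le d p q : p \is d.-homog -> q \is d.-homog ->
  coef_sqsum (p * q) <= 2 ^+ (d + d) * (coef_sqsum p * coef_sqsum q).
Proof.
move=> hp hq.
pose s := [seq (a, b) | a <- msupp p, b <- msupp q].
pose c (ab : 'X_{1..n} * 'X_{1..n}) := p@_ab.1 * q@_ab.2.
have pqE g : (p * q)@_g = \sum_(ab <- s | mnm_add ab.1 ab.2 == g) c ab.
  rewrite mpolyME raddf_sum [RHS]big_mkcond /=; apply: eq_bigr => ab _.
  by rewrite mcoeffZ mcoeffX /c; case: eqP; rewrite ?mulr1 ?mulr0.
have sq g : g \in msupp (p * q) -> `|(p * q)@_g| ^+ 2 <=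
    2 ^+ (d + d) * \sum_(ab <- s | mnm_add ab.1 ab.2 == g) `|c ab| ^+ 2.
  move=> gpq; have gd : mdeg g = (d + d)%N by have /dhomogP := dhomogM hp hq; apply.
  rewrite pqE -big_filter -[X in _ * X]big_filter; set t := filter _ _.
  apply: (@le_trans _ _ ((\sum_(ab <- t) `|c ab|) ^+ 2)).
    by rewrite lerXn2r ?nnegrE ?sumr_ge0 // ler_norm_sum.
  apply: le_trans (sqr_sum_le_size _ _) _ => //.
  apply: ler_wpM2r; first by apply: sumr_ge0 => m _; rewrite exprn_ge0.
  have st ab : ab \in t -> mnm_add ab.1 ab.2 = g by rewrite mem_filter => /andP[/eqP].
  rewrite -natrX ler_nat -gd -(size_map fst); apply: size_mnm_le.
    rewrite map_inj_in_uniq; first by rewrite filter_uniq // allpairs_uniq ?msupp_uniq // => -[? ?] [].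
    move=> [a b] [a' b'] /st /= E /st /= E' aa; rewrite -aa in E' *; congr pair.
    by apply: (@addmI _ a); rewrite E.
  by apply/allP => _ /mapP[ab /st <- ->]; apply: lem_addr.
rewrite /coef_sqsum.
apply: (@le_trans _ _ (\sum_(g <- msupp (p * q)) 2 ^+ (d + d) *
     \sum_(ab <- s | mnm_add ab.1 ab.2 == g) `|c ab| ^+ 2)).
  by rewrite big_seq_cond [leRHS]big_seq_cond; apply: ler_sum => g /andP[/sq].
rewrite -mulr_sumr; apply: ler_wpM2l; first by rewrite exprn_ge0.
rewrite (exchange_big_dep predT) //= mulr_suml.
have -> : \sum_(a <- msupp p) `|p@_a| ^+ 2 * (\sum_(b <- msupp q) `|q@_b| ^+ 2) =
    \sum_(ab <- s) `|c ab| ^+ 2.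
  rewrite big_allpairs /=; apply: eq_bigr => a _; rewrite mulr_sumr.
  by apply: eq_bigr => b _; rewrite normrM exprMn.
apply: ler_sum => ab _; rewrite -big_filter; set l := filter _ _.
(* A pair [ab] contributes to one product monomial only. *)
have : (size l <= 1)%N.
  rewrite (@uniq_leq_size _ l [:: mnm_add ab.1 ab.2]) ?filter_uniq ?msupp_uniq //.
  by move=> g; rewrite mem_filter inE eq_sym => /andP[].
case: l => [|g [|//]] _; first by rewrite big_nil exprn_ge0.
by rewrite big_seq1.
Qed.

(** The hypercontractive bound from [L^2] to [L^4]: [|p|^4] is the squared modulus of [p * p], and
    Parseval is exact for it because [d + d < N]. *)
Lemma torus_fourth_moment_le N (w : C) d p :
  N.-primitive_root w -> (d + d < N)%N -> p \is d.-homog ->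
  \sum_(x : {ffun 'I_n -> 'I_N}) `|p.@[torus_point w x]| ^+ 4 <=
  N%:R ^+ n * (4 ^+ d * coef_sqsum p ^+ 2).
Proof.
move=> wP dN hp.
have hpp : p * p \is (d + d).-homog := dhomogM hp hp.
have E x : `|p.@[torus_point w x]| ^+ 4 = `|(p * p).@[torus_point w x]| ^+ 2.
  by rewrite mevalM normrM -expr2 -exprM.
under eq_bigr do rewrite E.
rewrite (parseval_torus wP) ?(leq_trans (msize_dhomog hpp)) //.
apply: ler_wpM2l; first by rewrite exprn_ge0 // ler0n.
apply: le_trans (coef_sqsumM_le hp hp) _.
by rewrite -expr2 addnn -mul2n exprM -natrX.
Qed.

End TorusMeans.

(** * Coefficients of one-variable polynomials from their values on the circle *)

Section CircleCoefficients.
Variables (C : numClosedFieldType) (N : nat) (w : C).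
Hypothesis wP : N.-primitive_root w.

Lemma circle_coef (q : {poly C}) (k : nat) : (size q <= N)%N -> (k < N)%N ->
  \sum_(j < N) q.[w ^+ j] * (w ^+ (j * k))^* = N%:R * q`_k.
Proof.
move=> qN kN.
under eq_bigr => j _ do rewrite (horner_coef_wide _ qN) mulr_suml.
rewrite exchange_big (bigD1 (Ordinal kN)) //= [X in _ + X]big1 ?addr0 => [|i ik].
  under eq_bigr => j _ do rewrite -exprM -mulrA.
  by rewrite -mulr_sumr (prim_root_orthogonality wP) eqxx mulr1 mulrC.
under eq_bigr => j _ do rewrite -exprM -mulrA.
rewrite -mulr_sumr (prim_root_orthogonality wP) !modn_small //.
by rewrite -val_eqE /= in ik; rewrite (negPf ik) !mulr0.
Qed.

(** Cauchy's estimate, with finite Fourier inversion in place of the contour integral. *)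
Lemma circle_coef_le (q : {poly C}) (k : nat) (B : C) :
  (size q <= N)%N -> (k < N)%N -> (forall j : 'I_N, `|q.[w ^+ j]| <= B) -> `|q`_k| <= B.
Proof.
move=> qN kN hB; have N0 : 0 < N%:R :> C by rewrite ltr0n (prim_order_gt0 wP).
rewrite -(ler_pM2l N0) -{1}(ger0_norm (ltW N0)) -normrM -circle_coef //.
apply: le_trans (ler_norm_sum _ _ _) _.
rewrite mulr_natl -[X in _ *+ X]card_ord -sumr_const; apply: ler_sum => j _.
by rewrite normrM norm_conjC normrX (prim_root_norm wP) expr1n mulr1.
Qed.

(* Caratheodory: [M - c f] has nonnegative real part for a unimodular [c] with
   [c f(0) >= 0], and adding its conjugate does not change coefficient [k]. *)
Lemma caratheodory (q : {poly C}) (k : nat) (M : C) :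
  (size q + size q <= N)%N -> (0 < k < size q)%N ->
  (forall j : 'I_N, `|q.[w ^+ j]| <= M) -> `|q`_k| <= 2 * (M - `|q`_0|).
Proof.
move=> qN /andP[k0 kq] hM; have N0 : 0 < N%:R :> C by rewrite ltr0n (prim_order_gt0 wP).
have sq : (size q <= N)%N by apply: leq_trans qN; rewrite leq_addr.
have M0 : 0 <= M.
  by apply: le_trans (hM (Ordinal (prim_order_gt0 wP))); apply: normr_ge0.
have [c [c1 cq]] : exists c : C, `|c| = 1 /\ c * q`_0 = `|q`_0|.
  have [->|q0] := eqVneq q`_0 0; first by exists 1; rewrite normr1 mulr0 normr0.
  exists (`|q`_0| / q`_0); rewrite normrM normfV normr_id mulfV ?normr_eq0 //.
  by rewrite divfK.
pose g := M%:P - c *: q.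
have sg : (size g <= size q)%N.
  rewrite (leq_trans (size_polyD _ _)) // geq_max size_polyC size_polyN.
  rewrite (leq_trans (leq_b1 _)) ?(leq_trans k0) ?(ltnW kq) //=.
  exact: size_scale_leq.
pose h j : C := g.[w ^+ j] + (g.[w ^+ j])^*.
have hE (x : C) : x + x^* = 'Re x * 2 by rewrite ReE divfK // pnatr_eq0.
have h0 (j : 'I_N) : 0 <= h j.
  rewrite /h hE mulr_ge0 // /g hornerD hornerN hornerC hornerZ raddfB /=.
  rewrite (Creal_ReP _ _) ?ger0_real // subr_ge0.
  apply: le_trans (hM j); rewrite -[X in _ <= X]mul1r -c1 -normrM.
  apply: le_trans (real_ler_norm (Creal_Re _)) _.
  exact: (leif_normC_Re_Creal _).1.
have hk : \sum_(j < N) h j * (w ^+ (j * k))^* = - (N%:R * (c * q`_k)).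
  rewrite /h; under eq_bigr => j _ do rewrite mulrDl -rmorphM /=.
  rewrite big_split /= circle_coef ?(leq_trans sg) ?(leq_trans kq) //.
  (* The conjugate of [g] carries only the frequencies [- i] with [i < size q]. Since
     [0 < i + k < N], none of them meets frequency [k]. *)
  rewrite -rmorph_sum /= [X in _ + X](_ : _ = 0).
    rewrite addr0 /g coefB coefC coefZ.
    by rewrite (negPf (lt0n_neq0 k0)) sub0r mulrN.
  apply: etrans (rmorph0 (@Num.conj C)); congr (_^*).
  under eq_bigr => j _ do rewrite (horner_coef_wide _ sg) mulr_suml.
  rewrite exchange_big big1 // => i _.
  under eq_bigr => j _ do rewrite -mulrA -exprM -exprD -mulnDr -[w ^+ _]mulr1.
  under eq_bigr => j _ do rewrite -(rmorph1 (@Num.conj C)) -(expr0 w) -[in X in _ * X](muln0 j).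
  rewrite -mulr_sumr (prim_root_orthogonality wP) mod0n modn_small.
    by rewrite addn_eq0 (negPf (lt0n_neq0 k0)) andbF !mulr0.
  by apply: leq_trans qN; rewrite -addSn leq_add // ltnW.
have hs : \sum_(j < N) h j = N%:R * (2 * (M - `|q`_0|)).
  have C0 (f : 'I_N -> C) : \sum_j f j = \sum_j f j * (w ^+ (j * 0))^*.
    by apply: eq_bigr => j _; rewrite muln0 expr0 rmorph1 mulr1.
  have g0 : g`_0 = M - `|q`_0| by rewrite /g coefB coefC coefZ /= cq.
  have N1 : (0 < N)%N by apply: prim_order_gt0 wP.
  rewrite /h big_split /= -rmorph_sum /= C0 circle_coef ?(leq_trans sg) // g0.
  rewrite (conj_Creal _); last by rewrite realM ?realn // realB // ger0_real.
  by rewrite mulrCA -mulrDr -mulr2n mulrnAr [RHS]mulr_natl.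
(* As [h] is nonnegative, its Fourier coefficient at [k] is at most its mean, which [hs]
   computes. *)
rewrite -(ler_pM2l N0) -hs; have <- : `|N%:R * (c * q`_k)| = N%:R * `|q`_k|.
  by rewrite !normrM c1 mul1r ger0_norm // ltW.
rewrite -normrN -hk; apply: le_trans (ler_norm_sum _ _ _) _; apply: ler_sum => j _.
by rewrite normrM norm_conjC normrX (prim_root_norm wP) expr1n mulr1 ger0_norm.
Qed.
End CircleCoefficients.

(** * Directional derivatives and Cauchy estimates *)

Section DirectionalDerivative.
Import mpoly.
Variables (C : numClosedFieldType) (n : nat).
Implicit Types (p q : {mpoly C[n]}) (z u : 'I_n -> C).

(** The restriction of [p] to the complex line [z + t u], as a polynomial in [t]; it reduces
    estimates in [n] variables to the circle. *)
Definition line_poly z u p : {poly C} := mmap (@polyC C) (fun k => (z k)%:P + u k *: 'X) p.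

Lemma horner_line_poly z u p t : (line_poly z u p).[t] = p.@[fun k => z k + t * u k].
Proof.
rewrite /line_poly /mmap horner_sum mevalE; apply: eq_bigr => m _.
rewrite hornerCM horner_prod; congr (_ * _); apply: eq_bigr => k _.
by rewrite horner_exp hornerD hornerC hornerZ hornerX mulrC.
Qed.

Definition dir_deriv u p : {mpoly C[n]} := \sum_i u i *: p^`M(i).

(** Both sides satisfy the Leibniz rule relative to evaluation at [z], so agreement on 1 and on the
    variables passes to monomials, and then to [p] by linearity. *)
Lemma coef1_line_poly z u p : (line_poly z u p)`_1 = (dir_deriv u p).@[z].
Proof.
have L0 q : (line_poly z u q)`_0 = q.@[z].
  rewrite -horner_coef0 horner_line_poly; apply: meval_eq => k.
  by rewrite mul0r addr0.
have LM q r : line_poly z u (q * r) = line_poly z u q * line_poly z u r by rewrite /line_poly rmorphM.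
pose Q q := (line_poly z u q)`_1 = (dir_deriv u q).@[z].
have Q1 : Q 1.
  rewrite /Q /line_poly rmorph1 coefC /= /dir_deriv.
  by rewrite big1 ?meval0 // => i _; rewrite -mpolyC1 mderivC scaler0.
have QM q r : Q q -> Q r -> Q (q * r).
  rewrite /Q LM coefM !big_ord_recl big_ord0 /= !L0 => -> ->.
  rewrite /dir_deriv !raddf_sum addr0 /= mulr_sumr mulr_suml -big_split /=.
  apply: eq_bigr => i _; rewrite mderivM !mevalZ mevalD !mevalM mulrDr.
  by rewrite [RHS]addrC mulrCA !mulrA.
have QX i : Q 'X_i.
  rewrite /Q /line_poly mmapX mmap1U coefD coefC coefZ coefX /= add0r mulr1.
  rewrite /dir_deriv raddf_sum (bigD1 i) //= big1 ?addr0 => [|j ji].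
    rewrite mevalZ mderivX mnm1E eqxx scale1r.
    rewrite (_ : mnm_sub _ _ = 0%MM) ?mpolyX0 ?meval1 ?mulr1 //.
    by apply/mnmP=> k; rewrite mnmBE subnn mnm0E.
  by rewrite mevalZ mderivX mnm1E eq_sym (negPf ji) scale0r meval0 mulr0.
elim/mpolyind: p => [|c m p _ _ IH].
  rewrite /line_poly mmap0 coef0 /dir_deriv big1 ?meval0 // => i _.
  by rewrite mderiv0 scaler0.
have Qm : Q 'X_[m].
  rewrite mpolyXE_id; apply: (big_ind Q) => // i _; elim: (m i) => [|k IHk].
    by rewrite expr0.
  by rewrite exprS; apply: QM.
rewrite /Q in Qm IH *.
rewrite /line_poly mmapD mmapZ coefD coefCM -!/(line_poly _ _ _) Qm IH.
rewrite -mevalZ -mevalD /dir_deriv scaler_sumr -big_split /=; congr (_.@[_]).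
by apply: eq_bigr => i _; rewrite mderivD mderivZ scalerDr !scalerA mulrC.
Qed.

Lemma meval_dhomogZ d c p z : p \is d.-homog ->
  p.@[fun k => c * z k] = c ^+ d * p.@[z].
Proof.
move=> /dhomogP hp; rewrite !mevalE mulr_sumr big_seq_cond [RHS]big_seq_cond.
apply: eq_bigr => m /andP[/hp /= <- _]; rewrite mulrCA; congr (_ * _).
rewrite mdegE -prodrXr -big_split /=.
by apply: eq_bigr => k _; rewrite exprMn.
Qed.

Lemma mderiv_dhomog d p i : p \is d.-homog -> p^`M(i) \is d.-1.-homog.
Proof.
move=> /dhomogP hp; apply/dhomogP => m; rewrite mcoeff_msupp mcoeff_deriv => hm.
have : (m + U_(i))%MM \in msupp p.
  by rewrite mcoeff_msupp; apply: contraNneq hm => ->; rewrite mul0rn.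
by move/hp => /= <-; rewrite mdegD mdeg1 addn1.
Qed.

Lemma dir_deriv_dhomog d p u : p \is d.-homog -> dir_deriv u p \is d.-1.-homog.
Proof. by move=> hp; apply: rpred_sum => i _; apply: rpredZ; apply: mderiv_dhomog. Qed.

(** Cauchy's estimate on the circle of radius [1 / M] about [z]: it stays in the polydisc of radius
    [1 + 1 / M], where homogeneity costs [(1 + 1 / M) ^ d]. Taking [M = d] makes the total factor at
    most [e d]. *)
Lemma dir_deriv_le d M (B : C) p z u : (0 < M)%N -> p \is d.-homog ->
  (forall y, (forall k, `|y k| <= 1) -> `|p.@[y]| <= B) ->
  (forall k, `|z k| <= 1) -> (forall k, `|u k| <= 1) ->
  `|(dir_deriv u p).@[z]| <= M%:R * (1 + M%:R^-1) ^+ d * B.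
Proof.
move=> M0 hp pB z1 u1.
have Mp : 0 < M%:R :> C by rewrite ltr0n.
set r : C := M%:R^-1; have rp : 0 < r by rewrite invr_gt0.
have r1 : 0 < 1 + r by rewrite addr_gt0.
pose ur k := r * u k.
(* The bound [1 < N] makes index 1 admissible in [circle_coef_le]. *)
have [N [w [sN wP]]] := exists_large_prim_root C (maxn 1 (size (line_poly z ur p))).
move: sN; rewrite gtn_max => /andP[N1 /ltnW sN].
have : `|(line_poly z ur p)`_1| <= (1 + r) ^+ d * B.
  apply: (circle_coef_le wP) => // j; rewrite horner_line_poly.
  pose y k := (1 + r)^-1 * (z k + w ^+ j * ur k).
  rewrite (_ : p.@[_] = p.@[fun k => (1 + r) * y k]); last first.
    by apply: meval_eq => k; rewrite /y mulVKf // gt_eqF.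
  rewrite (meval_dhomogZ _ _ hp) normrM normrX (ger0_norm (ltW r1)).
  apply: ler_wpM2l; first by rewrite exprn_ge0 // ltW.
  apply: pB => k; rewrite /y normrM normfV (ger0_norm (ltW r1)) mulrC ler_pdivrMr // mul1r.
  apply: le_trans (ler_normD _ _) _; apply: lerD => //.
  rewrite !normrM normrX (prim_root_norm wP) expr1n mul1r (ger0_norm (ltW rp)).
  by rewrite -[leRHS]mulr1 ler_pM2l.
have -> : (line_poly z ur p)`_1 = r * (dir_deriv u p).@[z].
  rewrite coef1_line_poly /dir_deriv !raddf_sum /= mulr_sumr.
  by apply: eq_bigr => i _; rewrite !mevalZ mulrA.
by rewrite normrM (ger0_norm (ltW rp)) -(ler_pM2l Mp) mulVKf ?gt_eqF // mulrA.
Qed.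

Lemma dir_deriv2_le d M (B : C) p z u v : (0 < M)%N -> p \is d.-homog ->
  (forall y, (forall k, `|y k| <= 1) -> `|p.@[y]| <= B) ->
  (forall k, `|z k| <= 1) -> (forall k, `|u k| <= 1) -> (forall k, `|v k| <= 1) ->
  `|(dir_deriv v (dir_deriv u p)).@[z]| <= (M%:R * (1 + M%:R^-1) ^+ d) ^+ 2 * B.
Proof.
move=> M0 hp pB z1 u1 v1.
have B0 : 0 <= B by apply: le_trans (pB (fun=> 0) _); rewrite ?normr_ge0 // => k; rewrite normr0.
have Mp : 0 < M%:R :> C by rewrite ltr0n.
have rp : 1 <= 1 + M%:R^-1 :> C by rewrite lerDl invr_ge0 ltW.
have r0 : 0 <= 1 + M%:R^-1 :> C by apply: le_trans rp.
apply: le_trans (dir_deriv_le M0 (dir_deriv_dhomog u hp) (B := M%:R * (1 + M%:R^-1) ^+ d * B) _ z1 v1) _.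
  by move=> y y1; apply: dir_deriv_le.
rewrite expr2 -[X in _ <= X]mulrA; apply: ler_wpM2r; first by rewrite !mulr_ge0 ?exprn_ge0 // ltW.
(* The first derivative has degree [d.-1]; this exponent is weakened to [d]. *)
by rewrite ler_wpM2l ?(ltW Mp) // ler_weXn2l // leq_pred.
Qed.

End DirectionalDerivative.

(** * Scalar inequalities and interpolation of moments *)

Section RealInequalities.
Variable R : rcfType.
Implicit Types (x y : R).

Lemma exists_cube_root x : 0 <= x -> exists y, (0 <= y) && (y ^+ 3 == x).
Proof.
move=> x0; pose p : {poly R} := 'X^3 - x%:P.
have x1 : 0 <= x + 1 by rewrite addr_ge0.
have [||y yI /rootP yr] := @poly_ivt R p 0 (x + 1) => //.
  rewrite /p !hornerE expr0n /= sub0r oppr_le0 x0 /= subr_ge0.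
  by nra.
exists y; rewrite (andP yI).1 /=; move: yr; rewrite /p !hornerE => /eqP.
by rewrite subr_eq0.
Qed.

(** Cube roots keep exponents integral: if [c] is the cube root of a modulus [X], then [X ^ (4/3)],
    [X ^ 2] and [X ^ 4] are [c ^+ 4], [c ^+ 6] and [c ^+ 12]. Negative arguments get the value 0. *)
Definition cbrt x : R :=
  if @idP (0 <= x) is ReflectT h then xchoose (exists_cube_root h) else 0.

Lemma cbrt_ge0 x : 0 <= cbrt x.
Proof.
rewrite /cbrt; case: {-}_ / idP => // h.
by have /andP[] := xchooseP (exists_cube_root h).
Qed.

Lemma cbrtK x : 0 <= x -> cbrt x ^+ 3 = x.
Proof.
rewrite /cbrt; case: {-}_ / idP => // h _.
by have /andP[_ /eqP] := xchooseP (exists_cube_root h).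
Qed.

(** Interpolation between exponents by cutting at the threshold [l]: one term suffices below it, the
    other above. The next three lemmas follow the same pattern; choosing the threshold later
    replaces Hölder's inequality. *)
Lemma young_2_1_4 x l : 0 <= x -> 0 < l -> x ^+ 2 <= l * x + x ^+ 4 / l ^+ 2.
Proof.
move=> x0 l0; have [xl|lx] := lerP x l.
  apply: (@le_trans _ _ (l * x)); first by rewrite expr2 ler_wpM2r.
  by rewrite lerDl divr_ge0 ?exprn_ge0 // ltW.
apply: (@le_trans _ _ (x ^+ 4 / l ^+ 2)).
  rewrite ler_pdivlMr ?exprn_gt0 // (exprD x 2 2) ler_wpM2l ?exprn_ge0 //.
  by rewrite lerXn2r ?nnegrE // ltW.
by rewrite lerDr mulr_ge0 // ltW.
Qed.

Lemma young_6_4_12 x l : 0 <= x -> 0 < l ->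
  x ^+ 6 <= l ^+ 2 * x ^+ 4 + x ^+ 12 / l ^+ 6.
Proof.
move=> x0 l0; have [xl|lx] := lerP x l.
  apply: (@le_trans _ _ (l ^+ 2 * x ^+ 4)).
    rewrite (exprD x 2 4) ler_wpM2r ?exprn_ge0 //.
    by rewrite lerXn2r ?nnegrE // ltW.
  by rewrite lerDl divr_ge0 ?exprn_ge0 // ltW.
apply: (@le_trans _ _ (x ^+ 12 / l ^+ 6)).
  rewrite ler_pdivlMr ?exprn_gt0 // (exprD x 6 6) ler_wpM2l ?exprn_ge0 //.
  by rewrite lerXn2r ?nnegrE // ltW.
by rewrite lerDr mulr_ge0 ?exprn_ge0 // ltW.
Qed.

Lemma young_4_6_3 x s : 0 <= x -> 0 < s ->
  x ^+ 4 <= x ^+ 6 / s ^+ 2 + x ^+ 3 * s.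
Proof.
move=> x0 s0; have [xs|sx] := lerP x s.
  apply: (@le_trans _ _ (x ^+ 3 * s)); first by rewrite exprSr ler_wpM2l ?exprn_ge0.
  by rewrite lerDr divr_ge0 ?exprn_ge0 // ltW.
apply: (@le_trans _ _ (x ^+ 6 / s ^+ 2)).
  rewrite ler_pdivlMr ?exprn_gt0 // (exprD x 4 2) ler_wpM2l ?exprn_ge0 //.
  by rewrite lerXn2r ?nnegrE // ltW.
by rewrite lerDl mulr_ge0 ?exprn_ge0 // ltW.
Qed.

Lemma young_3_4 x u : 0 <= x -> 0 < u -> x ^+ 3 <= u ^+ 3 + x ^+ 4 / u.
Proof.
move=> x0 u0; have [xu|ux] := lerP x u.
  apply: (@le_trans _ _ (u ^+ 3)); first by rewrite lerXn2r ?nnegrE // ltW.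
  by rewrite lerDl divr_ge0 ?exprn_ge0 // ltW.
apply: (@le_trans _ _ (x ^+ 4 / u)).
  by rewrite ler_pdivlMr // [x ^+ 4]exprSr ler_wpM2l ?exprn_ge0 // ltW.
by rewrite lerDr exprn_ge0 // ltW.
Qed.

Variable T : finType.

(** Here [t] plays the number of points and [q] the [L^2] norm. With threshold [s q] in
    [young_2_1_4], the fourth-moment term is at most half of the second moment and is absorbed. *)
Lemma l2_le_l1_of_fourth_moment (Y : T -> R) (t q K s : R) :
  (forall i, 0 <= Y i) -> 0 < t -> 0 <= q -> 0 <= s -> 2 * K <= s ^+ 2 -> 0 < K ->
  \sum_i Y i ^+ 2 = t * q ^+ 2 -> \sum_i Y i ^+ 4 <= t * (K * q ^+ 4) ->
  t * q <= 2 * s * \sum_i Y i.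
Proof.
move=> Y0 t0 q0 s0 Ks K0 S2 S4.
have [->|qn0] := eqVneq q 0; first by rewrite mulr0 !mulr_ge0 ?sumr_ge0.
have qp : 0 < q by rewrite lt_neqAle eq_sym qn0.
have sp : 0 < s.
  rewrite lt_neqAle s0 andbT; apply: contraTneq Ks => <-.
  by rewrite expr0n /= -ltNge mulr_gt0.
have lp : 0 < s * q by apply: mulr_gt0.
have H : t * q ^+ 2 <= s * q * (\sum_i Y i) + t * q ^+ 2 / 2.
  rewrite -{1}S2; apply: (@le_trans _ _ (\sum_i (s * q * Y i + Y i ^+ 4 / (s * q) ^+ 2))).
    by apply: ler_sum => i _; apply: young_2_1_4.
  rewrite big_split /= -mulr_sumr lerD2l -mulr_suml.
  rewrite ler_pdivrMr ?exprn_gt0 //; apply: le_trans S4 _.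
  rewrite -subr_ge0 (_ : _ - _ = t * q ^+ 4 / 2 * (s ^+ 2 - 2 * K)); last by field.
  by rewrite mulr_ge0 ?subr_ge0 // divr_ge0 // mulr_ge0 ?exprn_ge0 // ltW.
rewrite -(ler_pM2r qp); move: H; set S := \sum_i _; lra.
Qed.

(** The same absorption, with threshold [k d]. As [c] and [d] stand for cube roots of the moduli and
    of their [L^2] norm, the conclusion compares [L^2] with [L^(4/3)]. *)
Lemma l2_le_l43_of_fourth_moment (c : T -> R) (t d K k : R) :
  (forall i, 0 <= c i) -> 0 < t -> 0 <= d -> 0 < k -> 2 * K <= k ^+ 6 ->
  \sum_i c i ^+ 6 = t * d ^+ 6 -> \sum_i c i ^+ 12 <= t * (K * d ^+ 12) ->
  t * d ^+ 4 <= 2 * k ^+ 2 * \sum_i c i ^+ 4.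
Proof.
move=> c0 t0 d0 kp Kk S6 S12.
have S0 : 0 <= \sum_i c i ^+ 4 by apply: sumr_ge0 => i _; rewrite exprn_ge0.
have [->|dn0] := eqVneq d 0.
  by rewrite expr0n mulr0 !mulr_ge0 ?exprn_ge0 // ltW.
have dp : 0 < d by rewrite lt_neqAle eq_sym dn0.
have lp : 0 < k * d by apply: mulr_gt0.
have H : t * d ^+ 6 <= (k * d) ^+ 2 * (\sum_i c i ^+ 4) + t * d ^+ 6 / 2.
  rewrite -{1}S6; apply: (@le_trans _ _ (\sum_i ((k * d) ^+ 2 * c i ^+ 4 + c i ^+ 12 / (k * d) ^+ 6))).
    by apply: ler_sum => i _; apply: young_6_4_12.
  rewrite big_split /= -mulr_sumr lerD2l -mulr_suml.
  rewrite ler_pdivrMr ?exprn_gt0 //; apply: le_trans S12 _.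
  rewrite -subr_ge0 (_ : _ - _ = t * d ^+ 12 / 2 * (k ^+ 6 - 2 * K)); last by field.
  by rewrite mulr_ge0 ?subr_ge0 // divr_ge0 // mulr_ge0 ?exprn_ge0 // ltW.
have d2p : 0 < d ^+ 2 by rewrite exprn_gt0.
rewrite -(ler_pM2r d2p); move: H; set S := \sum_i _.
rewrite (_ : t * d ^+ 4 * d ^+ 2 = t * d ^+ 6); last by ring.
rewrite exprMn; lra.
Qed.

Lemma cauchy_schwarz_sum (x y : T -> R) (a b : R) :
  0 <= a -> 0 <= b -> \sum_i x i ^+ 2 = a ^+ 2 -> \sum_i y i ^+ 2 = b ^+ 2 ->
  \sum_i x i * y i <= a * b.
Proof.
have z0 (f : T -> R) : \sum_i f i ^+ 2 = 0 ^+ 2 -> forall i, f i = 0.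
  rewrite expr0n /= => /psumr_eq0P h i; apply/eqP; rewrite -sqrf_eq0.
  by rewrite h // => j _; apply: sqr_ge0.
move=> a0 b0 Ha Hb.
have [aE|an0] := eqVneq a 0.
  rewrite aE in Ha *; rewrite mul0r big1 // => i _; by rewrite (z0 _ Ha) mul0r.
have [bE|bn0] := eqVneq b 0.
  rewrite bE in Hb *; rewrite mulr0 big1 // => i _; by rewrite (z0 _ Hb) mulr0.
have ap : 0 < a by rewrite lt_neqAle eq_sym an0.
have bp : 0 < b by rewrite lt_neqAle eq_sym bn0.
(* The weights are balanced so that each of the two sums equals [a b / 2]. *)
apply: (@le_trans _ _ (\sum_i ((b / (2 * a)) * x i ^+ 2 + (a / (2 * b)) * y i ^+ 2))).
  apply: ler_sum => i _; rewrite -subr_ge0.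
  have -> : (b / (2 * a)) * x i ^+ 2 + (a / (2 * b)) * y i ^+ 2 - x i * y i =
     (b * x i - a * y i) ^+ 2 / (2 * a * b) by field; apply/andP.
  by rewrite divr_ge0 ?sqr_ge0 // !mulr_ge0.
rewrite big_split /= -!mulr_sumr Ha Hb.
by rewrite le_eqVlt; apply/orP; left; apply/eqP; field; apply/andP.
Qed.

End RealInequalities.

(** * Littlewood's 4/3 inequality *)

Section Littlewood.
Variables (R : rcfType) (I J : finType).

(** The matrix entries are [c i j ^+ 3], with row and column [l2] norms [r] and [t]. In each row the
    exponent 4/3 is interpolated between the [l2] norm [r i] and the [l1] norm [S i]; the column
    norms control the squares of the [S i]. *)
Lemma littlewood_four_thirds (c : I -> J -> R) (r : I -> R) (t : J -> R) :
  (forall i j, 0 <= c i j) -> (forall i, 0 <= r i) -> (forall j, 0 <= t j) ->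
  (forall i, \sum_j c i j ^+ 6 = r i ^+ 2) -> (forall j, \sum_i c i j ^+ 6 = t j ^+ 2) ->
  \sum_i r i <= 1 -> \sum_j t j <= 1 ->
  \sum_i \sum_j c i j ^+ 4 <= 2.
Proof.
move=> c0 r0 t0 rE tE r1 t1.
pose S i := \sum_j c i j ^+ 3.
have S0 i : 0 <= S i by apply: sumr_ge0 => j _; rewrite exprn_ge0.
(* Minkowski's inequality for the columns, by expanding the square and applying Cauchy-Schwarz to
   each pair of columns. *)
have S2 : \sum_i S i ^+ 2 <= 1.
  apply: (@le_trans _ _ ((\sum_j t j) ^+ 2)); last first.
    by rewrite -(expr1n _ 2) lerXn2r ?nnegrE ?sumr_ge0.
  have -> : \sum_i S i ^+ 2 = \sum_j \sum_k \sum_i c i j ^+ 3 * c i k ^+ 3.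
    under eq_bigr => i _ do (rewrite expr2 /S mulr_suml; under eq_bigr => j _ do rewrite mulr_sumr).
    by rewrite exchange_big; apply: eq_bigr => j _; rewrite exchange_big.
  rewrite expr2 mulr_suml; apply: ler_sum => j _; rewrite mulr_sumr; apply: ler_sum => k _.
  by apply: cauchy_schwarz_sum => //; rewrite -tE; apply: eq_bigr => i _; rewrite -exprM.
have row i : \sum_j c i j ^+ 4 <= r i + (S i ^+ 2 + r i) / 2.
  have [ri|ri] := eqVneq (r i) 0.
    rewrite ri add0r addr0 big1 ?divr_ge0 ?exprn_ge0 // => j _.
    have : \sum_j c i j ^+ 6 = 0 by rewrite rE ri expr0n.
    move/psumr_eq0P => /(_ (fun j _ => exprn_ge0 6 (c0 i j))) /(_ j isT) /eqP.
    by rewrite expf_eq0 /= => /eqP ->; rewrite expr0n.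
  have rp : 0 < r i by rewrite lt_neqAle eq_sym ri r0.
  (* With threshold [sqrt (r i)] the first term sums to [r i], and the second, [S i * s], is at most
     [(S i ^+ 2 + r i) / 2]. *)
  set s := Num.sqrt (r i); have sp : 0 < s by rewrite sqrtr_gt0.
  have ss : s ^+ 2 = r i by rewrite sqr_sqrtr // ltW.
  apply: (@le_trans _ _ (\sum_j (c i j ^+ 6 / s ^+ 2 + c i j ^+ 3 * s))).
    by apply: ler_sum => j _; apply: young_4_6_3.
  rewrite big_split /= -!mulr_suml rE ss -/(S i) expr2 mulfK // lerD2l.
  by rewrite -ss; have := sqr_ge0 (S i - s); nra.
apply: (@le_trans _ _ (\sum_i (r i + (S i ^+ 2 + r i) / 2))); first exact: ler_sum.
by rewrite big_split /= -mulr_suml big_split /=; lra.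
Qed.

(* Chooses the threshold [u = sqrt (k / n)] in [young_3_4]. *)
Lemma sum_cubes_le_of_fourth_powers (d : I -> J -> R) (n : nat) (k : R) :
  (0 < n)%N -> #|I| = n -> #|J| = n -> 0 < k -> (forall i j, 0 <= d i j) ->
  \sum_i \sum_j d i j ^+ 4 <= 4 * k ^+ 2 ->
  \sum_i \sum_j d i j ^+ 3 <= 5 * Num.sqrt (k ^+ 3 * n%:R).
Proof.
move=> n0 cI cJ kp d0 H; have np : 0 < n%:R :> R by rewrite ltr0n.
set u := Num.sqrt (k / n%:R).
have up : 0 < u by rewrite sqrtr_gt0 divr_gt0.
have uu : u ^+ 2 = k / n%:R by rewrite sqr_sqrtr // ltW // divr_gt0.
have kE : k = u ^+ 2 * n%:R by rewrite uu divfK // gt_eqF.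
apply: (@le_trans _ _ (\sum_(i : I) \sum_(j : J) (u ^+ 3 + d i j ^+ 4 / u))).
  by apply: ler_sum => i _; apply: ler_sum => j _; apply: young_3_4.
under eq_bigr => i _ do rewrite big_split /= sumr_const cJ -mulr_suml.
rewrite big_split /= sumr_const cI -mulr_suml -mulrnA -[u ^+ 3 *+ _]mulr_natr natrM.
have -> : Num.sqrt (k ^+ 3 * n%:R) = u ^+ 3 * n%:R ^+ 2.
  rewrite (_ : k ^+ 3 * n%:R = (u ^+ 3 * n%:R ^+ 2) ^+ 2); last by rewrite kE; ring.
  by rewrite sqrtr_sqr ger0_norm // mulr_ge0 ?exprn_ge0 // ltW.
apply: (@le_trans _ _ (u ^+ 3 * (n%:R * n%:R) + 4 * k ^+ 2 / u)).
  by rewrite lerD2l ler_wpM2r // invr_ge0 ltW.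
rewrite kE le_eqVlt; apply/orP; left; apply/eqP; field.
by rewrite gt_eqF.
Qed.

End Littlewood.

(** * Row norms of bilinear forms and [l2] norms of Hessian entries *)

Section HomogeneousCoefficients.
Import mpoly.
Local Open Scope complex_scope.
Variables (R : rcfType) (n : nat).
Local Notation C := R[i].
Local Notation nr := (@Normc.normc R).
Implicit Types (p q : {mpoly C[n]}) (z u v : 'I_n -> C).

Lemma normc_complex (x : C) : `|x| = (nr x)%:C.
Proof. by rewrite normc_def; case: x. Qed.

Lemma normc_ge0 (x : C) : 0 <= nr x.
Proof. by rewrite -ler0c -normc_complex normr_ge0. Qed.

(** The factor rotating [x] onto its modulus. At [x = 0] it is 0, so its modulus is only bounded by
    1. *)
Definition phase (x : C) : C := (nr x)%:C / x.

Lemma normc_phase_le1 x : nr (phase x) <= 1.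
Proof.
rewrite -lecR -normc_complex /phase -normc_complex normrM normfV normr_id.
by have [->|x0] := eqVneq x 0; rewrite ?normr0 ?mul0r // mulfV ?normr_eq0.
Qed.

Lemma mul_phase x : phase x * x = (nr x)%:C.
Proof.
rewrite /phase; have [->|x0] := eqVneq x 0; last by rewrite divfK.
by rewrite mulr0 Normc.normc0.
Qed.

Definition coef_l1 p : R := \sum_(m <- msupp p) nr p@_m.
Definition coef_l2sq p : R := \sum_(m <- msupp p) nr p@_m ^+ 2.
Definition coef_l2 p : R := Num.sqrt (coef_l2sq p).

Lemma coef_l1_ge0 p : 0 <= coef_l1 p.
Proof. by apply: sumr_ge0 => m _; apply: normc_ge0. Qed.

Lemma coef_l2sq_ge0 p : 0 <= coef_l2sq p.
Proof. by apply: sumr_ge0 => m _; rewrite exprn_ge0 ?normc_ge0. Qed.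

Lemma sqr_coef_l2 p : coef_l2 p ^+ 2 = coef_l2sq p.
Proof. by rewrite sqr_sqrtr ?coef_l2sq_ge0. Qed.

Lemma coef_l2sqE p : coef_sqsum p = (coef_l2sq p)%:C.
Proof.
rewrite /coef_sqsum /coef_l2sq rmorph_sum; apply: eq_bigr => m _.
by rewrite normc_complex rmorphXn.
Qed.

Lemma sum_msupp_wide p (f : C -> R) (s : seq 'X_{1..n}) :
  f 0 = 0 -> uniq s -> {subset msupp p <= s} ->
  \sum_(m <- msupp p) f p@_m = \sum_(m <- s) f p@_m.
Proof.
move=> f0 us sub; rewrite [RHS](bigID (mem (msupp p))) /= [X in _ + X]big1 ?addr0.
  rewrite -[RHS]big_filter; apply: perm_big; apply: uniq_perm; rewrite ?filter_uniq ?msupp_uniq //.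
  by move=> m; rewrite mem_filter /=; case: (boolP (m \in msupp p)) => // /sub ->.
by move=> m hm; rewrite memN_msupp_eq0.
Qed.

Lemma sum_le_coef_l1 p (s : seq 'X_{1..n}) : uniq s ->
  \sum_(m <- s) nr p@_m <= coef_l1 p.
Proof.
move=> us; rewrite /coef_l1.
rewrite (bigID (mem (msupp p))) /= [X in _ + X]big1 ?addr0 => [|m hm]; last first.
  by rewrite memN_msupp_eq0 // Normc.normc0.
rewrite [leRHS](bigID (mem s)) /= -[leLHS]big_filter -[X in _ <= X + _]big_filter.
rewrite (perm_big [seq m <- msupp p | m \in s]) /=.
  by rewrite lerDl; apply: sumr_ge0 => m _; apply: normc_ge0.
apply: uniq_perm; rewrite ?filter_uniq ?msupp_uniq // => m.
by rewrite !mem_filter andbC.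
Qed.

Section Torus.
Variables (N : nat) (w : C).
Hypothesis wP : N.-primitive_root w.
Local Notation pt x := (torus_point w x).

Lemma normc_torus_point (x : {ffun 'I_n -> 'I_N}) k : nr (pt x k) = 1.
Proof. by apply: complexI; rewrite -normc_complex (torus_point_norm wP). Qed.

Lemma torus_second_moment p : (msize p <= N)%N ->
  \sum_(x : {ffun 'I_n -> 'I_N}) nr p.@[pt x] ^+ 2 = N%:R ^+ n * coef_l2sq p.
Proof.
move=> pN; apply: complexI; rewrite rmorph_sum rmorphM rmorphXn rmorph_nat /=.
rewrite -coef_l2sqE -(parseval_torus wP) //.
by apply: eq_bigr => x _; rewrite normc_complex rmorphXn.
Qed.

Lemma torus_fourth_moment d p : (d + d < N)%N -> p \is d.-homog ->
  \sum_(x : {ffun 'I_n -> 'I_N}) nr p.@[pt x] ^+ 4 <=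
  N%:R ^+ n * (4 ^+ d * coef_l2 p ^+ 4).
Proof.
move=> dN hp; rewrite (exprM _ 2 2) sqr_coef_l2.
rewrite -lecR rmorph_sum !rmorphM !rmorphXn !rmorph_nat /= -coef_l2sqE.
apply: le_trans (torus_fourth_moment_le wP dN hp).
by apply: ler_sum => x _; rewrite normc_complex rmorphXn.
Qed.

End Torus.

(** A Khinchine argument: the [l2] norm of a row is at most 6 times the mean modulus of its linear
    form on the torus. At each point of the grid, suitable phases turn the sum of these moduli into
    one value of the bilinear form. *)
Lemma bilinear_row_norms_le (A : 'I_n -> 'I_n -> C) (B : R) :
  (forall u v, (forall k, nr (u k) <= 1) -> (forall k, nr (v k) <= 1) ->
     nr (\sum_i \sum_j u i * v j * A i j) <= B) ->
  \sum_i Num.sqrt (\sum_j nr (A i j) ^+ 2) <= 6 * B.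
Proof.
move=> AB; have [N [w [sN wP]]] := exists_large_prim_root C 2.
have N0 : 0 < N%:R ^+ n :> R by rewrite exprn_gt0 // ltr0n (prim_order_gt0 wP).
pose l i : {mpoly C[n]} := \sum_j A i j *: 'X_j.
have lh i : l i \is 1.-homog.
  by apply: rpred_sum => j _; apply: rpredZ; rewrite dhomogX /= mdeg1.
have lE i z : (l i).@[z] = \sum_j A i j * z j.
  by rewrite /l raddf_sum; apply: eq_bigr => j _; rewrite /= mevalZ mevalXU.
have lU i j : (l i)@_U_(j) = A i j.
  rewrite /l raddf_sum (bigD1 j) //= mcoeffZ mcoeffXU eqxx mulr1 big1 ?addr0 // => k kj.
  by rewrite mcoeffZ mcoeffXU (negPf kj) mulr0.
have l2 i : coef_l2 (l i) = Num.sqrt (\sum_j nr (A i j) ^+ 2).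
  congr Num.sqrt; rewrite /coef_l2sq.
  rewrite (sum_msupp_wide (f := fun x => nr x ^+ 2) (s := [seq U_(j)%MM | j : 'I_n])).
  - by rewrite big_map big_enum; apply: eq_bigr => j _; rewrite lU.
  - by rewrite Normc.normc0 expr0n.
  - by rewrite map_inj_uniq ?enum_uniq // => j k /eqP; rewrite eq_mnm1 => /eqP.
  move=> m hm; have /dhomogP/(_ m hm) /= /eqP/mdeg1P[j /eqP ->] := lh i.
  by apply/mapP; exists j; rewrite ?mem_enum.
rewrite -(ler_pM2l N0) mulr_sumr.
apply: (@le_trans _ _ (\sum_i 6 * \sum_(x : {ffun 'I_n -> 'I_N}) nr (l i).@[torus_point w x])).
  apply: ler_sum => i _; rewrite -l2.
  (* The fourth-moment constant in degree 1 is 4, and [s = 3] satisfies [2 * 4 <= s ^+ 2]. *)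
  rewrite (_ : 6 = 2 * 3); last by rewrite -natrM.
  apply: (l2_le_l1_of_fourth_moment (K := 4)) => //.
  - by move=> x; apply: normc_ge0.
  - exact: sqrtr_ge0.
  - by rewrite -natrX -natrM ler_nat.
  - rewrite (torus_second_moment wP) ?sqr_coef_l2 //.
    by apply: leq_trans (msize_dhomog (lh i)) (ltnW sN).
  by have := torus_fourth_moment wP (d := 1) sN (lh i); rewrite expr1.
rewrite -mulr_sumr mulrCA ler_pM2l ?ltr0n // exchange_big /=.
apply: (@le_trans _ _ (\sum_(x : {ffun 'I_n -> 'I_N}) B)); last first.
  by rewrite sumr_const card_ffun !card_ord -[B *+ _]mulr_natl natrX.
apply: ler_sum => x _.
pose u i := phase (l i).@[torus_point w x].
have := AB u (torus_point w x) (fun i => normc_phase_le1 _).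
have -> : \sum_i \sum_j u i * torus_point w x j * A i j = (\sum_i nr (l i).@[torus_point w x])%:C.
  rewrite rmorph_sum; apply: eq_bigr => i _; rewrite /= -mul_phase -/(u i) lE mulr_sumr.
  by apply: eq_bigr => j _; rewrite -mulrA [A _ _ * _]mulrC.
rewrite (_ : nr _%:C = `|\sum_i nr (l i).@[torus_point w x]|); last first.
  by apply: complexI; rewrite -normc_complex normc_def /= expr0n addr0 sqrtr_sqr.
move=> /(_ (fun k => _)) h; apply: le_trans (ler_norm _) (h _) => k.
by rewrite (normc_torus_point wP).
Qed.

Definition hessian p i j : {mpoly C[n]} := p^`M(i)^`M(j).

Lemma hessian_dhomog d p i j : p \is d.+2.-homog -> hessian p i j \is d.-homog.
Proof. by move=> hp; rewrite /hessian; do 2 apply: (mderiv_dhomog (d := _.+1)). Qed.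

Lemma meval_dir_deriv2 p u v z :
  (dir_deriv v (dir_deriv u p)).@[z] = \sum_i \sum_j u i * v j * (hessian p i j).@[z].
Proof.
rewrite exchange_big /dir_deriv raddf_sum /=; apply: eq_bigr => j _.
rewrite mevalZ (raddf_sum (mderiv j)) (raddf_sum (meval z)) mulr_sumr; apply: eq_bigr => i _.
by rewrite /= mderivZ mevalZ mulrA [v j * _]mulrC.
Qed.

(* Hypercontractivity [L^(4/3) -> L^2] of each entry of the Hessian, combined
   with Littlewood's 4/3 inequality at every point of the torus. *)
Lemma sum_hessian_l2_le d p : (0 < n)%N -> p \is d.+2.-homog ->
  (forall z u v, (forall k, nr (z k) <= 1) -> (forall k, nr (u k) <= 1) ->
     (forall k, nr (v k) <= 1) -> nr (dir_deriv v (dir_deriv u p)).@[z] <= 6^-1) ->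
  \sum_i \sum_j coef_l2 (hessian p i j) <= 5 * Num.sqrt (2 ^+ d.+1 * n%:R).
Proof.
move=> n0 hp pB.
have [N [w [sN wP]]] := exists_large_prim_root C (d + d).
have N0 : 0 < N%:R ^+ n :> R by rewrite exprn_gt0 // ltr0n (prim_order_gt0 wP).
pose c (x : {ffun 'I_n -> 'I_N}) i j := cbrt (nr (hessian p i j).@[torus_point w x]).
pose D i j := cbrt (coef_l2 (hessian p i j)).
(* Then [K ^+ 6 = 4 ^+ d.+1] is at least twice the fourth-moment constant [4 ^+ d]. *)
pose K : R := cbrt (2 ^+ d.+1).
have K3 : K ^+ 3 = 2 ^+ d.+1 by rewrite cbrtK // exprn_ge0.
have Kp : 0 < K.
  rewrite lt_neqAle cbrt_ge0 andbT; apply/eqP => K0.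
  by move/eqP: K3; rewrite -K0 expr0n eq_sym expf_eq0 /= pnatr_eq0.
have c3 x i j : c x i j ^+ 3 = nr (hessian p i j).@[torus_point w x].
  by rewrite cbrtK // normc_ge0.
have D3 i j : D i j ^+ 3 = coef_l2 (hessian p i j) by rewrite cbrtK // sqrtr_ge0.
have hL x : \sum_i \sum_j c x i j ^+ 4 <= 2.
  have c6 i j : c x i j ^+ 6 = nr (hessian p i j).@[torus_point w x] ^+ 2.
    by rewrite (exprM _ 3 2) c3.
  have h0 (T : finType) (f : T -> C) : 0 <= \sum_i nr (f i) ^+ 2.
    by apply: sumr_ge0 => i _; apply: sqr_ge0.
  have xt k : nr (torus_point w x k) <= 1 by rewrite (normc_torus_point wP).
  apply: (littlewood_four_thirds
    (r := fun i => Num.sqrt (\sum_j nr (hessian p i j).@[torus_point w x] ^+ 2))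
    (t := fun j => Num.sqrt (\sum_i nr (hessian p i j).@[torus_point w x] ^+ 2))).
  - by move=> i j; apply: cbrt_ge0.
  - by move=> i; apply: sqrtr_ge0.
  - by move=> j; apply: sqrtr_ge0.
  - by move=> i; rewrite sqr_sqrtr //; apply: eq_bigr => j _.
  - by move=> j; rewrite sqr_sqrtr //; apply: eq_bigr => i _.
  (* The normalization [6^-1] cancels the Khinchine constant, so row norms sum to at most 1; the
     transposed form handles the columns. *)
  - apply: le_trans (bilinear_row_norms_le (B := 6^-1) _) _; last by rewrite mulfV ?pnatr_eq0.
    by move=> u v u1 v1; rewrite -meval_dir_deriv2; apply: pB.
  - apply: le_trans (bilinear_row_norms_le (A := fun j i => (hessian p i j).@[_]) (B := 6^-1) _) _.
      move=> v u v1 u1; rewrite exchange_big /=.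
      under eq_bigr => i _ do under eq_bigr => j _ do rewrite [v j * _]mulrC.
      by rewrite -meval_dir_deriv2; apply: pB.
    by rewrite mulfV ?pnatr_eq0.
under eq_bigr => i _ do under eq_bigr => j _ do rewrite -D3.
rewrite -K3; apply: sum_cubes_le_of_fourth_powers; rewrite ?card_ord //.
  by move=> i j; apply: cbrt_ge0.
have entry i j : N%:R ^+ n * D i j ^+ 4 <= 2 * K ^+ 2 * \sum_x c x i j ^+ 4.
  apply: (l2_le_l43_of_fourth_moment (K := 4 ^+ d)) => //.
  - by move=> x; apply: cbrt_ge0.
  - exact: cbrt_ge0.
  - rewrite (exprM _ 3 2) K3 -exprM mulnC exprM (_ : 2 ^+ 2 = 4 :> R); last by rewrite -natrX.
    by rewrite exprS ler_wpM2r ?exprn_ge0 // ler_nat.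
  - under eq_bigr => x _ do rewrite (exprM _ 3 2) c3.
    rewrite (torus_second_moment wP) -?sqr_coef_l2 -?D3 -?exprM //.
    apply: leq_trans (msize_dhomog (hessian_dhomog i j hp)) _.
    by apply: leq_trans sN; rewrite ltnS leq_addr.
  under eq_bigr => x _ do rewrite (exprM _ 3 4) c3.
  rewrite (exprM _ 3 4) D3; apply: (torus_fourth_moment wP) => //.
  exact: hessian_dhomog.
rewrite -(ler_pM2l N0).
apply: (@le_trans _ _ (\sum_i \sum_j 2 * K ^+ 2 * \sum_x c x i j ^+ 4)).
  by rewrite mulr_sumr; apply: ler_sum => i _; rewrite mulr_sumr; apply: ler_sum => j _.
under eq_bigr => i _ do (rewrite -mulr_sumr exchange_big /=).
rewrite -mulr_sumr exchange_big /=.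
apply: (@le_trans _ _ (2 * K ^+ 2 * \sum_(x : {ffun 'I_n -> 'I_N}) 2)).
  apply: ler_wpM2l; first by rewrite mulr_ge0 ?exprn_ge0 // ltW.
  by apply: ler_sum.
rewrite sumr_const card_ffun !card_ord -[2 *+ _]mulr_natl natrX.
by rewrite le_eqVlt; apply/orP; left; apply/eqP; ring.
Qed.

End HomogeneousCoefficients.

(** * Coefficient sums of homogeneous polynomials and the majorant *)

Section CoefficientSums.
Import mpoly.
Local Open Scope complex_scope.
Variables (R : rcfType) (n : nat).
Local Notation C := R[i].
Local Notation nr := (@Normc.normc R).
Implicit Types (p q : {mpoly C[n]}) (z u v : 'I_n -> C).

Lemma normcX (x : C) k : nr (x ^+ k) = nr x ^+ k.
Proof. by apply: complexI; rewrite rmorphXn /= -!normc_complex normrX. Qed.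

Lemma normc_prod (I : finType) (F : I -> C) : nr (\prod_i F i) = \prod_i nr (F i).
Proof.
apply: complexI; rewrite rmorph_prod /= -normc_complex normr_prod.
by apply: eq_bigr => i _; rewrite normc_complex.
Qed.

Lemma normc_real (x : R) : 0 <= x -> nr x%:C = x.
Proof. by move=> x0; rewrite /= expr0n addr0 sqrtr_sqr ger0_norm. Qed.

(** Each monomial of positive degree contains some variable, and differentiating in it multiplies
    the coefficient by an integer at least 1. *)
Lemma coef_l1_mderiv_le d p : p \is d.+1.-homog ->
  coef_l1 p <= \sum_i coef_l1 p^`M(i).
Proof.
move=> /dhomogP hp.
have E i : \sum_(m <- msupp p | m i != 0%N) nr p@_m <= coef_l1 p^`M(i).
  rewrite -big_filter; set s := filter _ _.
  have sU m : m \in s -> (U_(i) <= m)%MM by rewrite mem_filter lep1mP => /andP[].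
  apply: (@le_trans _ _ (\sum_(m <- [seq (m - U_(i))%MM | m <- s]) nr p^`M(i)@_m)).
    rewrite big_map big_seq_cond [leRHS]big_seq_cond; apply: ler_sum => m /andP[/sU Um _].
    rewrite mcoeff_deriv submK // -[_ *+ _]mulr_natl Normc.normcM.
    rewrite -[leLHS]mul1r ler_wpM2r ?normc_ge0 //.
    by rewrite -(rmorph_nat (real_complex R)) normc_real ?ler0n // ler1n.
  apply: sum_le_coef_l1; rewrite map_inj_in_uniq ?filter_uniq ?msupp_uniq //.
  by move=> a b /sU ha /sU hb ab; rewrite -(submK ha) ab submK.
apply: le_trans (ler_sum _ (fun i _ => E i)).
rewrite (exchange_big_dep predT) //= /coef_l1 big_seq_cond [leRHS]big_seq_cond.
apply: ler_sum => m /andP[/hp /= md _].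
case: (pickP (fun i => m i != 0%N)) => [i mi|h].
  by rewrite (bigD1 i) //= lerDl sumr_ge0 // => j _; apply: normc_ge0.
by move: md; rewrite mdegE big1 // => i _; apply/eqP/negbFE/h.
Qed.

(* The generating series of the monomials in [n] variables is [(1 - x)^-n]. *)
Lemma count_dhomog_le d q (x : R) : 0 < x < 1 -> q \is d.-homog ->
  (size (msupp q))%:R <= (x ^+ d * (1 - x) ^+ n)^-1.
Proof.
move=> /andP[x0 x1] /dhomogP hq; have y0 : 0 < 1 - x by rewrite subr_gt0.
rewrite -[leRHS]mul1r ler_pdivlMr ?mulr_gt0 ?exprn_gt0 // mulrA.
pose F (m : 'X_{1..n}) : {ffun 'I_n -> 'I_d.+1} := [ffun k => inord (m k)].
have Fv m k : m \in msupp q -> (F m k : nat) = m k.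
  by move=> ms; rewrite ffunE inordK // ltnS -(hq m ms) /= mnm_le_mdeg.
have -> : (size (msupp q))%:R * x ^+ d =
    \sum_(f <- [seq F m | m <- msupp q]) \prod_k x ^+ f k.
  rewrite big_map -sum1_size natr_sum mulr_suml big_seq_cond [RHS]big_seq_cond.
  apply: eq_bigr => m /andP[ms _]; rewrite mul1r.
  rewrite (eq_bigr (fun k => x ^+ m k)) => [|k _]; last by rewrite Fv.
  by rewrite prodrXr -mdegE -(hq m ms).
have uF : uniq [seq F m | m <- msupp q].
  rewrite map_inj_in_uniq ?msupp_uniq // => a b sa sb E; apply/mnmP => k.
  by rewrite -(Fv a) // -(Fv b) // E.
have px (f : {ffun 'I_n -> 'I_d.+1}) : 0 <= \prod_k x ^+ f k.
  by apply: prodr_ge0 => k _; rewrite exprn_ge0 // ltW.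
apply: (@le_trans _ _ ((\sum_(f : {ffun 'I_n -> 'I_d.+1}) \prod_k x ^+ f k) * (1 - x) ^+ n)).
  apply: ler_wpM2r; first by rewrite exprn_ge0 // ltW.
  rewrite big_uniq //= [leRHS](bigID (mem [seq F m | m <- msupp q])) /= lerDl.
  by apply: sumr_ge0.
rewrite -(bigA_distr_bigA (fun k (j : 'I_d.+1) => x ^+ j)) /= prodr_const card_ord -exprMn.
apply: exprn_ile1.
  by rewrite mulr_ge0 ?(ltW y0) // sumr_ge0 // => j _; rewrite exprn_ge0 // ltW.
have := subrX1 x d.+1; rewrite -[x - 1]opprB mulNr => /eqP.
rewrite -subr_eq0 opprK => /eqP h.
have -> : (\sum_(j < d.+1) x ^+ j) * (1 - x) = 1 - x ^+ d.+1.
  by rewrite mulrC; apply/eqP; rewrite -subr_eq0 opprB addrC; apply/eqP.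
by rewrite lerBlDr lerDl exprn_ge0 // ltW.
Qed.

Lemma coef_l1_le_l2 d q (x : R) : 0 < x < 1 -> q \is d.-homog ->
  coef_l1 q <= Num.sqrt ((x ^+ d * (1 - x) ^+ n)^-1) * coef_l2 q.
Proof.
move=> x01 hq; have h := count_dhomog_le x01 hq.
have D0 : 0 <= (x ^+ d * (1 - x) ^+ n)^-1 by apply: le_trans h; rewrite ler0n.
rewrite -(@ler_pXn2r _ 2) ?nnegrE ?mulr_ge0 ?coef_l1_ge0 ?sqrtr_ge0 //.
rewrite exprMn sqr_sqrtr // sqr_coef_l2.
apply: le_trans (sqr_sum_le_size (msupp q) (f := fun m => nr q@_m) _) _.
  by move=> m; apply: normc_ge0.
by apply: ler_wpM2r => //; apply: coef_l2sq_ge0.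
Qed.

Lemma normc_dir_deriv2_le d (B : R) p z u v : p \is d.+1.-homog ->
  (forall y, (forall k, nr (y k) <= 1) -> nr p.@[y] <= B) ->
  (forall k, nr (z k) <= 1) -> (forall k, nr (u k) <= 1) -> (forall k, nr (v k) <= 1) ->
  nr (dir_deriv v (dir_deriv u p)).@[z] <= (d.+1%:R * (1 + d.+1%:R^-1) ^+ d.+1) ^+ 2 * B.
Proof.
have toC (y : 'I_n -> C) : (forall k, nr (y k) <= 1) -> forall k, `|y k| <= 1.
  by move=> y1 k; rewrite normc_complex (lecR _ 1).
have ofC (y : 'I_n -> C) : (forall k, `|y k| <= 1) -> forall k, nr (y k) <= 1.
  by move=> y1 k; rewrite -lecR -normc_complex.
move=> hp pB /toC z1 /toC u1 /toC v1.
have := dir_deriv2_le (M := d.+1) (B := B%:C) isT hp _ z1 u1 v1.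
rewrite normc_complex -(rmorph_nat (real_complex R)) -fmorphV -(rmorph1 (real_complex R)).
rewrite -rmorphD -rmorphXn -rmorphM -rmorphXn -rmorphM lecR /= rmorph1; apply.
by move=> y /ofC y1; rewrite normc_complex lecR; apply: pB.
Qed.

Lemma coef_l1Z (c : C) p : c != 0 -> coef_l1 (c *: p) = nr c * coef_l1 p.
Proof.
move=> c0; rewrite /coef_l1 (perm_big _ (msuppZ p c0)) mulr_sumr /=.
by apply: eq_bigr => m _; rewrite mcoeffZ Normc.normcM.
Qed.

(** Two applications of [coef_l1_mderiv_le] pass to the Hessian entries, of degree [d], whose [l1]
    norms are bounded by Cauchy-Schwarz and whose [l2] norms are bounded jointly. *)
Lemma coef_l1_homog_le d (B x : R) p : (0 < n)%N -> 0 < B -> 0 < x < 1 ->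
  p \is d.+2.-homog ->
  (forall y, (forall k, nr (y k) <= 1) -> nr p.@[y] <= B) ->
  coef_l1 p <= 30 * (d.+2%:R * (1 + d.+2%:R^-1) ^+ d.+2) ^+ 2 * B *
    (Num.sqrt (2 ^+ d.+1 * n%:R) * Num.sqrt ((x ^+ d * (1 - x) ^+ n)^-1)).
Proof.
move=> n0 B0 x01 hp pB.
set H := (_ * _) ^+ 2; have Hp : 0 < H.
  by rewrite exprn_gt0 // mulr_gt0 ?ltr0n // exprn_gt0 // addr_gt0 // invr_gt0 ltr0n.
set V := Num.sqrt (2 ^+ _ * _); set W := Num.sqrt (_^-1).
(* Rescaling brings the second derivatives below [6^-1]; undoing it gives the constant
   [30 = 6 * 5]. *)
pose c := (6 * H * B)^-1; have cp : 0 < c.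
  by rewrite invr_gt0; apply: mulr_gt0 => //; apply: mulr_gt0 => //; rewrite ltr0n.
have hq : c%:C *: p \is d.+2.-homog by exact: rpredZ.
have cn0 : c%:C != 0 by rewrite eq_complex /= eqxx andbT gt_eqF.
have qB y : (forall k, nr (y k) <= 1) -> nr (c%:C *: p).@[y] <= c * B.
  move=> y1; rewrite mevalZ Normc.normcM normc_real ?(ltW cp) // ler_pM2l //.
  exact: pB.
have S1 : \sum_i \sum_j coef_l2 (hessian (c%:C *: p) i j) <= 5 * V.
  apply: sum_hessian_l2_le => // z u v z1 u1 v1.
  apply: le_trans (normc_dir_deriv2_le hq qB z1 u1 v1) _; rewrite -/H.
  by rewrite le_eqVlt; apply/orP; left; apply/eqP; rewrite /c; field; rewrite !gt_eqF.
have S2 : coef_l1 (c%:C *: p) <= W * (5 * V).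
  apply: le_trans (coef_l1_mderiv_le hq) _.
  apply: (@le_trans _ _ (\sum_i \sum_j coef_l1 (hessian (c%:C *: p) i j))).
    by apply: ler_sum => i _; apply: (coef_l1_mderiv_le (d := d)); apply: mderiv_dhomog hq.
  apply: le_trans (ler_wpM2l (sqrtr_ge0 _) S1); rewrite mulr_sumr; apply: ler_sum => i _.
  rewrite mulr_sumr; apply: ler_sum => j _; apply: coef_l1_le_l2 => //.
  exact: hessian_dhomog.
move: S2; rewrite coef_l1Z // normc_real ?(ltW cp) // -ler_pdivlMl // => h.
apply: le_trans h _; rewrite /c invrK.
by rewrite le_eqVlt; apply/orP; left; apply/eqP; ring.
Qed.

(** The value at the point formed by the phases of the coefficients is their absolute sum. Degree 1
    is thus settled without second derivatives. *)
Lemma coef_l1_linear_le (B : R) p : p \is 1.-homog ->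
  (forall y, (forall k, nr (y k) <= 1) -> nr p.@[y] <= B) -> coef_l1 p <= B.
Proof.
move=> /dhomogP hp pB; pose y k := phase p@_U_(k).
apply: le_trans (pB y (fun k => normc_phase_le1 _)).
rewrite mevalE (_ : \sum_(m <- _) _ = (coef_l1 p)%:C) ?normc_real ?coef_l1_ge0 //.
rewrite /coef_l1 rmorph_sum big_seq_cond [RHS]big_seq_cond; apply: eq_bigr => m /andP[ms _].
have /= /eqP/mdeg1P[i /eqP ->] := hp m ms.
rewrite (bigD1 i) //= big1 => [|j ji]; rewrite mnm1E.
  by rewrite eqxx mulr1 expr1 -mul_phase mulrC.
by rewrite eq_sym (negPf ji).
Qed.

Lemma coef_line_poly0 z p d :
  (line_poly (fun=> 0) z p)`_d = (pihomog mdeg d p).@[z].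
Proof.
rewrite /line_poly /mmap coef_sum pihomogE raddf_sum [RHS]big_mkcond /=.
apply: eq_bigr => m _; rewrite /mmap1.
have -> : \prod_(i < n) ((0 : C)%:P + z i *: 'X) ^+ m i = (\prod_i z i ^+ m i) *: 'X^(mdeg m).
  rewrite mdegE -prodrXr -scaler_prod; apply: eq_bigr => i _.
  by rewrite add0r exprZn.
rewrite coefCM coefZ coefXn eq_sym; case: eqP => _; rewrite ?mulr0 //.
by rewrite mevalZ mevalX mulr1.
Qed.

Lemma meval_origin p : p.@[fun=> 0] = p@_0%MM.
Proof.
rewrite {2}[p]mpolyE mevalE raddf_sum; apply: eq_bigr => m _ /=.
rewrite mcoeffZ mcoeffX; congr (_ * _).
have [->|m0] := eqVneq m 0%MM.
  by rewrite big1 // => i _; rewrite mnm0E.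
case: (pickP (fun i => m i != 0%N)) => [i mi|h].
  by rewrite (bigD1 i) //= expr0n (negPf mi) mul0r.
by case/eqP: m0; apply/mnmP => i; rewrite mnm0E; apply/eqP/negbFE/h.
Qed.

(** Caratheodory's inequality on the slice of [p] through the origin in direction [rho z]. The
    factor [rho] keeps the unit circle of the slice inside the open polydisc, where the bound [M] is
    available. *)
Lemma pihomog_le (M rho : R) p d z : 0 < rho < 1 -> (0 < d)%N ->
  (forall y, (forall k, nr (y k) < 1) -> nr p.@[y] <= M) ->
  (forall k, nr (z k) <= 1) ->
  rho ^+ d * nr (pihomog mdeg d p).@[z] <= 2 * (M - nr p@_0%MM).
Proof.
move=> /andP[r0 r1] d0 pM z1.
pose zr k := rho%:C * z k; pose q := line_poly (fun=> 0) zr p.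
have p0 : q`_0 = p@_0%MM.
  rewrite -horner_coef0 horner_line_poly -meval_origin.
  by apply: meval_eq => k; rewrite add0r mul0r.
have qd : nr q`_d = rho ^+ d * nr (pihomog mdeg d p).@[z].
  rewrite coef_line_poly0 (meval_dhomogZ _ _ (pihomogP mdeg d p)) Normc.normcM normcX.
  by rewrite normc_real // ltW.
rewrite -qd -p0.
have pM0 : nr q`_0 <= M.
  by rewrite p0 -meval_origin; apply: pM => k; rewrite Normc.normc0.
have [sq|sq] := leqP (size q) d.
  by rewrite nth_default // Normc.normc0 mulr_ge0 // subr_ge0.
have [N [w [sN wP]]] := exists_large_prim_root C (size q + size q).
have := @caratheodory C N w wP q d M%:C (ltnW sN).
rewrite !normc_complex d0 sq -rmorphB -(rmorph_nat (real_complex R)) -rmorphM lecR; apply=> // j.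
rewrite normc_complex lecR horner_line_poly; apply: pM => k.
rewrite add0r /zr !Normc.normcM normcX normc_real ?(ltW r0) //.
have -> : nr w = 1 by apply: complexI; rewrite -normc_complex (prim_root_norm wP).
rewrite expr1n mul1r; apply: le_lt_trans r1.
by rewrite -[leRHS]mulr1 ler_pM2l.
Qed.

Lemma majorant_le p z (r : R) K : (msize p <= K.+1)%N ->
  (forall k, nr (z k) <= r) ->
  \sum_(m <- msupp p) nr (p@_m * \prod_(k < n) z k ^+ m k) <=
  nr p@_0%MM + \sum_(1 <= d < K.+1) r ^+ d * coef_l1 (pihomog mdeg d p).
Proof.
move=> pK zr.
have r0 (k : 'I_n) : 0 <= r by apply: le_trans (zr k); apply: normc_ge0.
have term m : nr (p@_m * \prod_(k < n) z k ^+ m k) <= r ^+ mdeg m * nr p@_m.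
  rewrite Normc.normcM mulrC ler_wpM2r ?normc_ge0 // normc_prod mdegE -prodrXr.
  apply: ler_prod => k _; rewrite normcX exprn_ge0 ?normc_ge0 //=.
  by rewrite lerXn2r ?nnegrE ?normc_ge0 ?(r0 k) //.
apply: le_trans (ler_sum _ (fun m _ => term m)) _.
have cf d m : (pihomog mdeg d p)@_m = if mdeg m == d then p@_m else 0.
  have pm : p@_m = \sum_(m' <- msupp p) p@_m' * (m' == m)%:R.
    by rewrite {1}[p]mpolyE raddf_sum; apply: eq_bigr => m' _; rewrite /= mcoeffZ mcoeffX.
  rewrite pihomogE raddf_sum /=; case: eqP => md.
    rewrite pm big_mkcond; apply: eq_bigr => m' _; rewrite mcoeffZ mcoeffX.
    by have [->|_] := eqVneq m' m; rewrite ?md ?eqxx // mulr0; case: ifP.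
  rewrite big1 // => m' /eqP md'; rewrite mcoeffZ mcoeffX.
  by case: eqP => [mm|]; rewrite ?mulr0 //; case: md; rewrite -mm.
have D d : r ^+ d * coef_l1 (pihomog mdeg d p) =
    \sum_(m <- msupp p | mdeg m == d) r ^+ mdeg m * nr p@_m.
  rewrite /coef_l1 (sum_msupp_wide (f := nr) (s := msupp p)) ?msupp_uniq ?Normc.normc0 //.
    rewrite mulr_sumr [RHS]big_mkcond; apply: eq_bigr => m _; rewrite cf.
    by case: eqP => [->|] //; rewrite Normc.normc0 mulr0.
  by move=> m; rewrite !mcoeff_msupp cf; case: ifP => //; rewrite eqxx.
rewrite (eq_bigr _ (fun d _ => D d)).
have -> : nr p@_0%MM = \sum_(m <- msupp p | mdeg m == 0%N) r ^+ mdeg m * nr p@_m.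
  rewrite -D expr0 mul1r /coef_l1 (sum_msupp_wide (f := nr) (s := [:: 0%MM])) //.
  - by rewrite big_seq1 cf mdeg0 eqxx.
  - exact: Normc.normc0.
  by move=> m; rewrite mcoeff_msupp cf inE -mdeg_eq0; case: ifP => //; rewrite eqxx.
rewrite -(@big_ltn _ _ _ 0 K.+1
  (fun d => \sum_(m <- msupp p | mdeg m == d) r ^+ mdeg m * nr p@_m)) //.
rewrite (exchange_big_dep predT) //= big_seq_cond [leRHS]big_seq_cond.
apply: ler_sum => m /andP[ms _].
have mK : (mdeg m < K.+1)%N by apply: leq_trans pK; apply: msize_mdeg_lt.
rewrite big_mkord (bigD1 (Ordinal mK)) //= lerDl; apply: sumr_ge0 => d /andP[_ _].
(* The sign of [r] is known only through a coordinate of [z]; without variables every monomial has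
   degree 0. *)
have [k0|k0] := posnP n; last by rewrite mulr_ge0 ?normc_ge0 // exprn_ge0 ?(r0 (Ordinal k0)).
have -> : mdeg m = 0%N.
  rewrite mdegE big1 // => i _; suff: false by [].
  by rewrite -(ltnn 0) -{2}k0 (leq_ltn_trans _ (ltn_ord i)).
by rewrite expr0 mul1r normc_ge0.
Qed.

(* The free parameter [x] of [coef_l1_le_l2] is taken to be [d / (n + d)]. *)
Definition homog_constant (d : nat) : R :=
  if d is e.+2 then
    let x := d%:R / (n + d)%:R in
    30 * (d%:R * (1 + d%:R^-1) ^+ d) ^+ 2 *
      (Num.sqrt (2 ^+ e.+1 * n%:R) * Num.sqrt ((x ^+ e * (1 - x) ^+ n)^-1))
  else 1.

Lemma homog_constant_ge0 d : 0 <= homog_constant d.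
Proof.
case: d => [|[|d]] //; rewrite /homog_constant mulr_ge0 //; last first.
  by rewrite mulr_ge0 ?sqrtr_ge0.
by rewrite mulr_ge0 ?ler0n // sqr_ge0.
Qed.

Lemma coef_l1_le_homog_constant d (B : R) p : (0 < n)%N -> (0 < d)%N -> 0 <= B ->
  p \is d.-homog -> (forall y, (forall k, nr (y k) <= 1) -> nr p.@[y] <= B) ->
  coef_l1 p <= homog_constant d * B.
Proof.
move=> n0 d0 B0 hp pB.
have A0 := homog_constant_ge0 d.
have main B' : 0 < B' -> (forall y, (forall k, nr (y k) <= 1) -> nr p.@[y] <= B') ->
    coef_l1 p <= homog_constant d * B'.
  case: d d0 hp {A0} => [//|[|e]] _ hp Bp pB'; first by rewrite mul1r; apply: coef_l1_linear_le.
  have x01 : 0 < (e.+2%:R / (n + e.+2)%:R : R) < 1.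
    have ne : (e.+2 < n + e.+2)%N by rewrite -[ltnLHS]add0n ltn_add2r.
    have np : 0 < (n + e.+2)%:R :> R by rewrite ltr0n (leq_ltn_trans _ ne).
    by apply/andP; split; [exact: divr_gt0 | rewrite ltr_pdivrMr // mul1r ltr_nat].
  apply: le_trans (coef_l1_homog_le n0 Bp x01 hp pB') _.
  by rewrite /homog_constant le_eqVlt; apply/orP; left; apply/eqP; ring.
move: B0; rewrite le_eqVlt => /orP[/eqP BE|]; last by move=> Bp; apply: main.
rewrite -BE mulr0 leNgt; apply/negP => cp.
have A1 : 0 < homog_constant d + 1 by rewrite ltr_wpDl.
(* For [B = 0], a nonzero coefficient sum would make this positive number a valid bound, and [main]
   would make the sum smaller than itself. *)
have Bp : 0 < coef_l1 p / (homog_constant d + 1) by rewrite divr_gt0.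
have B0 : B <= coef_l1 p / (homog_constant d + 1) by rewrite -BE ltW.
have := main _ Bp (fun y y1 => le_trans (pB y y1) B0).
rewrite mulrA ler_pdivlMr // mulrDr mulr1 mulrC gerDl.
by rewrite leNgt cp.
Qed.

(** The factor [rho ^+ d] in the radius cancels the loss in [pihomog_le]. The parts of positive
    degree then sum to at most [2 (M - a) / 2], where [a] is the modulus of [p] at the origin, and
    adding [a] gives [M]. *)
Lemma bohr_bound p (M rho s : R) z : (0 < n)%N -> 0 < rho < 1 -> 0 <= s ->
  (forall K, \sum_(1 <= d < K.+1) s ^+ d * homog_constant d <= 2^-1) ->
  (forall y, (forall k, nr (y k) < 1) -> nr p.@[y] <= M) ->
  (forall k, nr (z k) <= rho * s) ->
  \sum_(m <- msupp p) nr (p@_m * \prod_(k < n) z k ^+ m k) <= M.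
Proof.
move=> n0 r01 s0 sum_le pM zr; have /andP[r0 r1] := r01.
set a := nr p@_0%MM.
have aM : 0 <= M - a.
  by rewrite subr_ge0 /a -meval_origin; apply: pM => k; rewrite Normc.normc0.
apply: le_trans (majorant_le (leqnSn (msize p)) zr) _; rewrite -/a.
suff : \sum_(1 <= d < (msize p).+1) (rho * s) ^+ d * coef_l1 (pihomog mdeg d p) <= M - a by lra.
apply: (@le_trans _ _ (\sum_(1 <= d < (msize p).+1) s ^+ d * homog_constant d * (2 * (M - a)))).
  rewrite big_seq_cond [leRHS]big_seq_cond.
  apply: ler_sum => d; rewrite mem_index_iota => /andP[/andP[d0 _] _].
  have rd : 0 < rho ^+ d by rewrite exprn_gt0.
  have := @coef_l1_le_homog_constant d (2 * (M - a) / rho ^+ d) _ n0 d0 _ (pihomogP mdeg d p).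
  rewrite divr_ge0 ?(ltW rd) ?mulr_ge0 // => /(_ isT) h.
  have -> : s ^+ d * homog_constant d * (2 * (M - a)) =
      s ^+ d * (rho ^+ d * (homog_constant d * (2 * (M - a) / rho ^+ d))).
    by field; rewrite gt_eqF.
  rewrite exprMn [leLHS](_ : _ = s ^+ d * (rho ^+ d * coef_l1 (pihomog mdeg d p))); last by ring.
  apply: ler_wpM2l; first exact: exprn_ge0.
  apply: ler_wpM2l; [exact: ltW | apply: h => y y1].
  by rewrite ler_pdivlMr // mulrC; apply: pihomog_le.
rewrite -mulr_suml; apply: le_trans (ler_wpM2r _ (sum_le _)) _; first by rewrite mulr_ge0.
by rewrite mulrA mulVf ?mul1r // pnatr_eq0.
Qed.

End CoefficientSums.

(* Imported only here, because the notations of [mpoly] clash with it. *)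
From mathcomp Require Import all_classical all_reals all_analysis.
Import numFieldNormedType.Exports.

(** * Size of the degree-[m] term, uniformly in [m] *)

Section Asymptotics.
Variable R : realType.
Implicit Types (a c x y s L : R).

Lemma le_expR x : x <= expR x.
Proof. by apply: le_trans (expR_ge1Dx x); rewrite lerDr. Qed.

Lemma expR1M_le x : expR 1 * x <= expR x.
Proof.
have -> : expR x = expR 1 * expR (x - 1) by rewrite -expRD addrC subrK.
rewrite ler_wpM2l ?expR_ge0 //; apply: le_trans (expR_ge1Dx _).
by rewrite addrC subrK.
Qed.

Lemma pow_1Dinv_le m x : 0 <= x -> (1 + x / m%:R) ^+ m <= expR x.
Proof.
move=> x0; have [->|m0] := posnP m; first by rewrite expr0 (le_trans _ (expR_ge1Dx x)) // lerDl.
have mp : 0 < m%:R :> R by rewrite ltr0n.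
have -> : expR x = expR (x / m%:R) ^+ m by rewrite -expRM_natl mulrC divfK // gt_eqF.
rewrite lerXn2r ?nnegrE ?expR_ge0 ?expR_ge1Dx //.
by rewrite addr_ge0 // divr_ge0 // ltW.
Qed.

Lemma cube_expRN_le a m : 0 < a -> m%:R ^+ 3 * expR (- a) ^+ m <= (3 / a) ^+ 3.
Proof.
move=> a0; have -> : expR (- a) ^+ m = expR (- (a / 3) * m%:R) ^+ 3.
  by rewrite -!expRM_natl; congr expR; field.
rewrite -exprMn lerXn2r ?nnegrE ?mulr_ge0 ?ler0n ?expR_ge0 ?invr_ge0 ?(ltW a0) //.
rewrite mulNr expRN ler_pdivrMr ?expR_gt0 //.
have := le_expR (a / 3 * m%:R); set E := expR _ => h.
rewrite mulrAC ler_pdivlMr //; nra.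
Qed.

(** With [y = s L (1/m + 1/n)], the bounds [(1 + m/n) ^ n <= e ^ m] and [e y <= e ^ y] give
    [e ^ (m y)], that is [n ^ s] times [e ^ (s L m / n)]. Dropping two degrees gains a square of
    order [(m / n) ^ 2] against one lost factor [n], so a power [n ^ (s - 1)] remains, which decays
    because [s < 1]. *)
Lemma radicand_le (n e : nat) c a L (m := e.+2) (s := expR (- (8 * a))) :
  (0 < n)%N -> 0 <= c -> 0 < a -> 0 <= L -> expR L = n%:R ->
  2 * c ^+ 2 = s ^+ 2 -> s * L / n%:R <= 4 * a ->
  (c ^+ 2 * (L / n%:R)) ^+ m * (2 ^+ e.+1 * n%:R) *
    ((m%:R / (n + m)%:R) ^+ e * (1 - m%:R / (n + m)%:R) ^+ n)^-1 <=
  (m%:R * expR (- ((1 - s) / 2 * L)) * expR (- (2 * a)) ^+ m) ^+ 2.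
Proof.
move=> n0 c0 a0 L0 eL cs sL.
have np : 0 < n%:R :> R by rewrite ltr0n.
have mp : 0 < m%:R :> R by rewrite ltr0n.
have nmp : 0 < (n + m)%:R :> R by rewrite ltr0n addnS.
have nn0 : n%:R != 0 :> R by rewrite gt_eqF.
have mn0 : m%:R != 0 :> R by rewrite gt_eqF.
have nmn0 : n%:R + m%:R != 0 :> R by rewrite -natrD gt_eqF.
have s0 : 0 < s by apply: expR_gt0.
set y := s * L * (m%:R^-1 + n%:R^-1).
have y0 : 0 <= y by rewrite mulr_ge0 ?addr_ge0 ?invr_ge0 ?(ltW mp) ?(ltW np) // mulr_ge0 // ltW.
have step1 : (c ^+ 2 * (L / n%:R)) ^+ m * (2 ^+ e.+1 * n%:R) *
    ((m%:R / (n + m)%:R) ^+ e * (1 - m%:R / (n + m)%:R) ^+ n)^-1 =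
    (s * y) ^+ m * (1 + m%:R / n%:R) ^+ n * (m%:R ^+ 2 * n%:R / (n + m)%:R ^+ 2 / 2).
  have -> : (1 - m%:R / (n + m)%:R) = (1 + m%:R / n%:R)^-1 :> R.
    by rewrite natrD; field; rewrite nmn0 nn0.
  rewrite exprVn invfM invrK -[(_ ^+ e)^-1]exprVn.
  set X := (m%:R / (n + m)%:R)^-1; set A := c ^+ 2 * (L / n%:R); set G := (1 + _) ^+ n.
  have -> : s * y = A * 2 * X.
    rewrite /y (_ : s * _ = s ^+ 2 * L * (m%:R^-1 + n%:R^-1)); last by ring.
    by rewrite -cs /X /A natrD; field; rewrite mn0 nn0 nmn0.
  have -> : (A * 2 * X) ^+ m = A ^+ m * (2 * 2 ^+ e.+1) * (X ^+ e * X ^+ 2).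
    by rewrite !exprMn -exprS -[X ^+ e * _]exprD addn2.
  have -> : X ^+ 2 = (n + m)%:R ^+ 2 / m%:R ^+ 2 by rewrite /X invfM invrK mulrC exprMn exprVn.
  move: (A ^+ m) (2 ^+ e.+1) (X ^+ e) => u v w; rewrite natrD.
  by field; rewrite nmn0 mn0.
rewrite step1.
have G1 := pow_1Dinv_le n (ltW mp).
have G2 : m%:R ^+ 2 * n%:R / (n + m)%:R ^+ 2 / 2 <= m%:R ^+ 2 / n%:R :> R.
  rewrite (_ : _ / 2 = m%:R ^+ 2 * (n%:R / (n + m)%:R ^+ 2 / 2)); last by rewrite !mulrA.
  apply: ler_wpM2l; first by rewrite exprn_ge0 // ltW.
  rewrite -[X in _ <= X]mul1r ler_pdivlMr //.
  rewrite (_ : _ * n%:R = n%:R ^+ 2 / (2 * (n + m)%:R ^+ 2)); last first.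
    by rewrite natrD; field.
  rewrite ler_pdivrMr ?mulr_gt0 ?exprn_gt0 // mul1r natrD -subr_ge0.
  rewrite (_ : _ - _ = n%:R ^+ 2 + 4 * n%:R * m%:R + 2 * m%:R ^+ 2); last by ring.
  by rewrite !addr_ge0 ?mulr_ge0 ?exprn_ge0 ?ler0n.
have Y1 : (s * y) ^+ m * expR m%:R <= s ^+ m * expR (m%:R * y).
  rewrite exprMn -mulrA ler_wpM2l ?exprn_ge0 ?(ltW s0) //.
  have -> : expR m%:R = expR 1 ^+ m :> R by rewrite -expRM_natl mulr1.
  rewrite expRM_natl -exprMn lerXn2r ?nnegrE ?mulr_ge0 ?expR_ge0 //.
  by rewrite mulrC expR1M_le.
apply: (@le_trans _ _ (s ^+ m * expR (m%:R * y) * (m%:R ^+ 2 / n%:R))).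
  apply: ler_pM => //.
  - apply: mulr_ge0; apply: exprn_ge0; first by rewrite mulr_ge0 // ltW.
    by rewrite addr_ge0 // divr_ge0 // ltW.
  apply: le_trans Y1; apply: ler_wpM2l G1; by rewrite exprn_ge0 // mulr_ge0 // ltW.
have -> : m%:R * y = s * L + m%:R * (s * L / n%:R) by rewrite /y; field; rewrite mn0 nn0.
rewrite expRD expRM_natl; set q := expR (s * L / n%:R).
(* Half of the decay [8 a] pays for the error [s L / n]. *)
have q1 : s * q <= expR (- (4 * a)) by rewrite /s /q -expRD ler_expR; lra.
have -> : s ^+ m * (expR (s * L) * q ^+ m) * (m%:R ^+ 2 / n%:R) =
    m%:R ^+ 2 * expR (- ((1 - s) * L)) * (s * q) ^+ m.
  rewrite (_ : - ((1 - s) * L) = s * L - L); last by ring.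
  by rewrite expRD expRN eL exprMn; ring.
have -> : (m%:R * expR (- ((1 - s) / 2 * L)) * expR (- (2 * a)) ^+ m) ^+ 2 =
    m%:R ^+ 2 * expR (- ((1 - s) * L)) * expR (- (4 * a)) ^+ m.
  rewrite exprMn [X in X * _]exprMn exprAC -[expR _ ^+ 2]expRM_natl -[expR (- (2 * a)) ^+ 2]expRM_natl.
  by congr (_ * expR _ * expR _ ^+ _); field.
rewrite ler_wpM2l ?mulr_ge0 ?exprn_ge0 ?expR_ge0 //.
by rewrite lerXn2r ?nnegrE ?mulr_ge0 ?expR_ge0.
Qed.

(** Square root of [radicand_le]. The factor [m ^ 3], of which [m ^ 2] comes from the two
    derivatives, is absorbed by one of the two factors [expR (- a) ^+ m]; the other is kept for
    summation. *)
Lemma term_le (n e : nat) c a L (m := e.+2) (s := expR (- (8 * a))) :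
  (0 < n)%N -> 0 <= c -> 0 < a -> 0 <= L -> expR L = n%:R ->
  2 * c ^+ 2 = s ^+ 2 -> s * L / n%:R <= 4 * a ->
  (c * Num.sqrt (L / n%:R)) ^+ m * homog_constant R n m <=
  30 * expR 1 ^+ 2 * (3 / a) ^+ 3 * expR (- ((1 - s) / 2 * L)) * expR (- a) ^+ m.
Proof.
move=> n0 c0 a0 L0 eL cs sL.
have Ln0 : 0 <= L / n%:R by rewrite divr_ge0.
have := radicand_le e n0 c0 a0 L0 eL cs sL; rewrite -/m -/s; set D := (_ * _ ^+ n)^-1 => rad.
set W := _ * _ ^+ m in rad.
have W0 : 0 <= W.
  by apply: mulr_ge0; [rewrite mulr_ge0 ?expR_ge0 | exact/exprn_ge0/expR_ge0].
have D0 : 0 <= D.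
  have mnm : m%:R <= (n + m)%:R :> R by rewrite ler_nat leq_addl.
  have nm0 : 0 < (n + m)%:R :> R by rewrite ltr0n addnS.
  rewrite invr_ge0 mulr_ge0 ?exprn_ge0 ?divr_ge0 //.
  by rewrite subr_ge0 ler_pdivrMr // mul1r.
have sq : (c * Num.sqrt (L / n%:R)) ^+ m * (Num.sqrt (2 ^+ e.+1 * n%:R) * Num.sqrt D) <= W.
  have -> : c * Num.sqrt (L / n%:R) = Num.sqrt (c ^+ 2 * (L / n%:R)).
    by rewrite [RHS]sqrtrM ?sqr_ge0 // sqrtr_sqr ger0_norm.
  rewrite -[W]ger0_norm // -sqrtr_sqr; apply: le_trans (ler_wsqrtr rad).
  have sX (y : R) k : 0 <= y -> Num.sqrt y ^+ k = Num.sqrt (y ^+ k).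
    by move=> y0; rewrite -[y in RHS](sqr_sqrtr y0) exprAC sqrtr_sqr ger0_norm // exprn_ge0 ?sqrtr_ge0.
  have c20 : 0 <= c ^+ 2 * (L / n%:R) by rewrite mulr_ge0 ?sqr_ge0.
  have s3 (u v w : R) : 0 <= u -> 0 <= v ->
      Num.sqrt u * (Num.sqrt v * Num.sqrt w) = Num.sqrt (u * v * w).
    by move=> u0 v0; rewrite sqrtrM ?mulr_ge0 // sqrtrM // mulrA.
  by rewrite sX // s3 ?exprn_ge0 // mulr_ge0 ?exprn_ge0.
have H0 : (m%:R * (1 + m%:R^-1) ^+ m) ^+ 2 <= m%:R ^+ 2 * expR 1 ^+ 2 :> R.
  rewrite exprMn ler_wpM2l ?exprn_ge0 // lerXn2r ?nnegrE ?expR_ge0 ?exprn_ge0 ?addr_ge0 ?invr_ge0 //.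
  by have := @pow_1Dinv_le m 1 ler01; rewrite mul1r.
rewrite /homog_constant -/m -/D.
rewrite [leLHS]mulrCA.
apply: (@le_trans _ _ (30 * (m%:R ^+ 2 * expR 1 ^+ 2) * W)).
  apply: ler_pM => //.
  - apply: mulr_ge0; last by rewrite mulr_ge0 ?sqrtr_ge0.
    by apply: exprn_ge0; rewrite mulr_ge0 ?sqrtr_ge0.
  by rewrite ler_wpM2l.
have := cube_expRN_le m a0 => h.
have -> : 30 * (m%:R ^+ 2 * expR 1 ^+ 2) * W =
    30 * expR 1 ^+ 2 * (m%:R ^+ 3 * expR (- a) ^+ m) * expR (- ((1 - s) / 2 * L)) * expR (- a) ^+ m.
  rewrite /W (_ : expR (- (2 * a)) = expR (- a) ^+ 2); last by rewrite -expRM_natl mulrN.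
  by rewrite -exprM mulnC exprM; ring.
by rewrite !ler_wpM2r ?exprn_ge0 ?expR_ge0 // ler_wpM2l ?mulr_ge0 ?exprn_ge0 ?expR_ge0.
Qed.

End Asymptotics.

(** * Summation over all degrees *)

Section BohrRadius.
Local Open Scope complex_scope.
Local Open Scope classical_set_scope.
Variable R : realType.
Implicit Types c r s : R.

Lemma geometric_sum_le (q : R) K : 0 < q < 1 -> \sum_(1 <= d < K.+1) q ^+ d <= (1 - q)^-1.
Proof.
move=> /andP[q0 q1]; have p1 : 0 < 1 - q by rewrite subr_gt0.
apply: (@le_trans _ _ (\sum_(0 <= d < K.+1) q ^+ d)).
  by rewrite [leRHS]big_ltn // lerDr.
rewrite -[leRHS]mul1r ler_pdivlMr // big_mkord mulrC.
have := subrX1 q K.+1; rewrite -[q - 1]opprB mulNr => /eqP; rewrite eq_sym eqr_oppLR => /eqP ->.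
by rewrite opprB lerBlDr lerDl exprn_ge0 // ltW.
Qed.

Lemma sum_homog_constant_le c : 0 < c -> 2 * c ^+ 2 < 1 ->
  exists L0 : R, forall n, (1 < n)%N -> L0 <= ln n%:R -> forall K,
    \sum_(1 <= d < K.+1) (c * Num.sqrt (ln n%:R / n%:R)) ^+ d * homog_constant R n d <= 2^-1.
Proof.
move=> c0 c2; set s := Num.sqrt (2 * c ^+ 2).
have c20 : 0 < 2 * c ^+ 2 by rewrite mulr_gt0 ?exprn_gt0.
have s0 : 0 < s by rewrite sqrtr_gt0.
have s2 : s ^+ 2 = 2 * c ^+ 2 by rewrite sqr_sqrtr // ltW.
have s1 : s < 1 by nra.
pose a := - ln s / 8.
have a0 : 0 < a by rewrite divr_gt0 // oppr_gt0 ln_lt0 // s0.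
have sE : s = expR (- (8 * a)).
  rewrite /a (_ : - (8 * _) = ln s); last by field.
  by rewrite lnK // posrE.
pose k := (1 - s) / 2; have k0 : 0 < k by rewrite divr_gt0 // subr_gt0.
have ea : 0 < expR (- a) < 1 by rewrite expR_gt0 /= -expR0 ltr_expR oppr_lt0.
have p1 : 0 < 1 - expR (- a) by rewrite subr_gt0; case/andP: ea.
pose Q := 30 * expR 1 ^+ 2 * (3 / a) ^+ 3 / (1 - expR (- a)) : R.
have q0 : 0 < 30 * expR 1 ^+ 2 * (3 / a) ^+ 3 :> R.
  have e0 : 0 < expR 1 :> R := expR_gt0 1.
  apply: mulr_gt0; last by apply: exprn_gt0; apply: divr_gt0.
  by apply: mulr_gt0 => //; apply: exprn_gt0.
have Q0 : 0 < Q by apply: divr_gt0.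
(* The summands serve in turn to bound the degree-1 term by 1/4, to verify [s L / n <= 4 a], and to
   bound all higher degrees together by 1/4. *)
exists (64 + a^-1 + 4 * Q / k) => n n1 hL K.
set L := ln n%:R in hL *.
have n0 : (0 < n)%N by apply: ltnW.
have np : 0 < n%:R :> R by rewrite ltr0n.
have eL : expR L = n%:R by rewrite lnK // posrE.
have ai : 0 < a^-1 by rewrite invr_gt0.
have Qk : 0 < 4 * Q / k by rewrite divr_gt0 // mulr_gt0.
have L64 : 64 <= L by lra.
have La : a^-1 <= L by lra.
have LQ : 4 * Q / k <= L by lra.
have Lp : 0 < L by lra.
(* This is [n = e ^ L >= (L / 2) ^ 2]. *)
have Ln : L / n%:R <= 4 / L.
  rewrite ler_pdivrMr // mulrAC ler_pdivlMr // -eL.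
  have -> : expR L = expR (L / 2) ^+ 2 by rewrite -expRM_natl; congr expR; field.
  have := le_expR (L / 2); set E := expR _ => h; nra.
have Ln0 : 0 <= L / n%:R by rewrite divr_ge0 ?ltW.
have sL : s * L / n%:R <= 4 * a.
  rewrite -mulrA; apply: (@le_trans _ _ (4 / L)); first by nra.
  have aL : 1 <= a * L by rewrite -ler_pdivrMl // mulr1.
  by rewrite ler_pdivrMr //; lra.
have first : c * Num.sqrt (L / n%:R) <= 4^-1.
  have y0 := sqrtr_ge0 (L / n%:R); have y2 := sqr_sqrtr Ln0.
  have LL : L / n%:R <= 16^-1.
    apply: le_trans Ln _; rewrite ler_pdivrMr //; lra.
  move: y0 y2; set y := Num.sqrt _ => y0 y2; nra.
have exps : Q * expR (- (k * L)) <= 4^-1.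
  rewrite expRN ler_pdivrMr ?expR_gt0 //.
  have := le_expR (k * L); rewrite ler_pdivrMr // in LQ; set E := expR _ => h; nra.
case: K => [|K]; first by rewrite big_geq.
rewrite big_ltn // expr1 mulr1.
suff : \sum_(2 <= d < K.+2) (c * Num.sqrt (L / n%:R)) ^+ d * homog_constant R n d <= 4^-1 by lra.
apply: le_trans exps.
apply: (@le_trans _ _ (\sum_(2 <= d < K.+2)
    30 * expR 1 ^+ 2 * (3 / a) ^+ 3 * expR (- (k * L)) * expR (- a) ^+ d)).
  rewrite big_seq_cond [leRHS]big_seq_cond.
  apply: ler_sum => -[|[|e]]; rewrite mem_index_iota //= => _.
  by rewrite /k sE; apply: term_le; rewrite // -?sE // ?ltW.
rewrite -mulr_sumr.
have G := geometric_sum_le K.+1 ea.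
have G2 : \sum_(2 <= d < K.+2) expR (- a) ^+ d <= (1 - expR (- a))^-1.
  by apply: le_trans G; rewrite [leRHS]big_ltn // lerDr ?exprn_ge0 ?expR_ge0.
rewrite (_ : Q * _ =
  30 * expR 1 ^+ 2 * (3 / a) ^+ 3 * expR (- (k * L)) * (1 - expR (- a))^-1); last first.
  by rewrite /Q; ring.
by apply: ler_wpM2l => //; rewrite mulr_ge0 ?expR_ge0 ?ltW.
Qed.

End BohrRadius.

(** * Existence of the Bohr radius and the lower limit *)

Section BohrRadiusLimit.
Local Open Scope complex_scope.
Local Open Scope classical_set_scope.
Variable R : realType.
Implicit Types c r s : R.

Lemma ereal_sup_meval_cases n (p : mpoly.mpoly n R[i])
    (S := [set (Normc.normc (mpoly.meval z p))%:E | z in polydisc R n]) :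
  ereal_sup S = +oo%E \/ exists2 M : R, ereal_sup S = M%:E &
    forall z, (forall k, Normc.normc (z k) < 1) -> Normc.normc (mpoly.meval z p) <= M.
Proof.
have ub (z : 'I_n -> R[i]) : (forall k, Normc.normc (z k) < 1) ->
    ((Normc.normc (mpoly.meval z p))%:E <= ereal_sup S)%E.
  by move=> z1; apply: ereal_sup_ubound; exists z.
move: ub; case: (ereal_sup S) => [M| |] ub; [right|by left|].
  by exists M => // z z1; rewrite -lee_fin; apply: ub.
(* The value [-oo] is impossible, since the origin lies in the polydisc. *)
by have := ub (fun=> 0); rewrite leNgt ltNyr => /(_ _)/negP; case=> // k; rewrite Normc.normc0.
Qed.

Lemma bohr_inequality_eventually c : 0 < c -> c < (Num.sqrt 2)^-1 ->
  exists L0 : R, forall n, (1 < n)%N -> L0 <= ln n%:R ->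
    bohr_inequality n (c * Num.sqrt (ln n%:R / n%:R)).
Proof.
(* The room between [c] and [c'] provides the contraction factor [rho = c / c'] of [bohr_bound]. *)
move=> c0 c1; pose c' := (c + (Num.sqrt 2)^-1) / 2.
have q0 : 0 < Num.sqrt 2 :> R by rewrite sqrtr_gt0.
have q2 : (Num.sqrt 2)^-1 ^+ 2 = 2^-1 :> R by rewrite exprVn sqr_sqrtr.
have qi : 0 < (Num.sqrt 2)^-1 :> R by rewrite invr_gt0.
have cc' : c < c' by rewrite /c'; lra.
have c'0 : 0 < c' by lra.
have c'2 : 2 * c' ^+ 2 < 1.
  have c'q : c' < (Num.sqrt 2)^-1 by rewrite /c'; lra.
  by move: q2 c'q; set q := (Num.sqrt 2)^-1; nra.
have [L0 hL] := sum_homog_constant_le c'0 c'2; exists L0 => n n1 nL p.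
have [->|[M -> pM]] := ereal_sup_meval_cases p; first by rewrite leey.
apply: ge_ereal_sup => _ [_ [z z1 <-] <-]; rewrite lee_fin.
have s0 : 0 <= c' * Num.sqrt (ln n%:R / n%:R) by rewrite mulr_ge0 ?sqrtr_ge0 // ltW.
have rho01 : 0 < c / c' < 1.
  by apply/andP; split; [exact: divr_gt0 | rewrite ltr_pdivrMr // mul1r].
apply: (bohr_bound (ltnW n1) rho01 s0 (hL n n1 nL) pM) => k.
have r0 : 0 <= c * Num.sqrt (ln n%:R / n%:R) by rewrite mulr_ge0 ?sqrtr_ge0 // ltW.
rewrite Normc.normcM normc_real // [leRHS](_ : _ = c * Num.sqrt (ln n%:R / n%:R)).
  by rewrite ler_piMr // ltW.
by rewrite mulrA divfK // gt_eqF.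
Qed.

(** Tested on a single variable at a modulus [t] strictly between [1 / s] and 1. This bounds the set
    of admissible radii. *)
Lemma bohr_inequality_le1 n s : (0 < n)%N -> 0 < s -> bohr_inequality n s -> s <= 1.
Proof.
move=> n0 s0 hs; rewrite leNgt; apply/negP => s1.
pose k0 := Ordinal n0; pose p := mpoly.mpolyX R[i] (mpoly.mnm1 k0).
pose t := (1 + s^-1) / 2.
have si : 0 < s^-1 by rewrite invr_gt0.
have si1 : s^-1 < 1 by rewrite invf_lt1.
have t0 : 0 <= t by rewrite /t; lra.
have t1 : t < 1 by rewrite /t; lra.
have pE z : mpoly.meval z p = z k0 by rewrite mpoly.mevalXU.
have := hs p.
have : (ereal_sup [set (Normc.normc (mpoly.meval z p))%:E | z in polydisc R n] <= 1%:E)%E.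
  by apply: ge_ereal_sup => _ [z z1 <-]; rewrite pE lee_fin ltW.
move=> h1 h2; have := le_trans h2 h1; apply/negP; rewrite -ltNge.
apply: (@lt_le_trans _ _ (s * t)%:E).
  rewrite lte_fin /t (_ : s * _ = (s + 1) / 2); first by lra.
  by field; rewrite gt_eqF.
apply: ereal_sup_ubound; exists (fun=> s%:C * t%:C).
  by exists (fun=> t%:C) => // k; rewrite normc_real.
congr EFin; rewrite /majorant mpoly.msuppX big_seq1 mpoly.mcoeffX eqxx mul1r.
rewrite -mpoly.mevalX mpoly.mevalXU Normc.normcM !normc_real //; exact: ltW.
Qed.

(** The supremum of the admissible radii is attained because the polydisc is open: a point of the
    polydisc scaled by the supremum already lies in one scaled by a slightly smaller admissible
    radius. *)
Lemma is_bohr_radius_exists n r : (0 < n)%N -> 0 < r -> bohr_inequality n r ->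
  exists K : R, is_bohr_radius n K.
Proof.
move=> n0 r0 hr; pose S := [set s : R | 0 < s /\ bohr_inequality n s].
have supS : has_sup S.
  by split; [exists r | exists 1 => s [s0 hs]; apply: bohr_inequality_le1 hs].
have Sup s : 0 < s -> bohr_inequality n s -> s <= sup S.
  by move=> s0 hs; apply: sup_upper_bound.
have K0 : 0 < sup S by apply: lt_le_trans r0 (Sup r r0 hr).
exists (sup S); split=> // p.
apply: ge_ereal_sup => _ [_ [z z1 <-] <-].
pose t := \big[Order.max/0]_(k < n) Normc.normc (z k).
have t1 : t < 1 by apply: Order.POrderTheory.bigmax_lt => // k _; apply: z1.
have tz k : Normc.normc (z k) <= t by apply: le_bigmax_cond.
have t0 : 0 <= t by apply: le_trans (tz (Ordinal n0)); apply: normc_ge0.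
have [s [s0 hs] st] : exists2 s : R, S s & sup S - sup S * (1 - t) < s.
  by apply: sup_adherent => //; rewrite mulr_gt0 // subr_gt0.
apply: le_trans (hs p); apply: ereal_sup_ubound.
exists (fun k => (sup S)%:C * z k) => //.
exists (fun k => (sup S / s)%:C * z k).
  move=> k; rewrite Normc.normcM normc_real ?divr_ge0 ?ltW //.
  rewrite mulrAC ltr_pdivrMr // mul1r; apply: le_lt_trans st.
  rewrite (_ : sup S - _ = sup S * t); last by ring.
  by rewrite ler_pM2l.
apply: funext => k; rewrite mulrA -rmorphM /=; congr (_%:C * _).
by rewrite mulrC divfK // gt_eqF.
Qed.

(** Existence of a largest radius rules out the default value 0 of [xget]. *)
Lemma bohr_radius_ge n r : (0 < n)%N -> 0 < r -> bohr_inequality n r -> r <= bohr_radius R n.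
Proof.
move=> n0 r0 hr.
have [_ _] : is_bohr_radius n (bohr_radius R n).
  exact: (xgetPex 0 (is_bohr_radius_exists n0 r0 hr)).
by apply.
Qed.

End BohrRadiusLimit.

Theorem mainTheorem6 (R : realType) (b : nat -> R)
    (b_def : forall n : nat, (1 < n)%N ->
       bohr_radius R n = b n * Num.sqrt (ln n%:R / n%:R)) :
  ((Num.sqrt 2)^-1%:E <= limn_einf (fun n => (b n)%:E))%E.
Proof.
have qi : 0 < (Num.sqrt 2)^-1 :> R by rewrite invr_gt0 sqrtr_gt0.
have main c : 0 < c -> c < (Num.sqrt 2)^-1 -> (c%:E <= limn_einf (fun n => (b n)%:E))%E.
  move=> c0 c1; have [L0 hL] := bohr_inequality_eventually c0 c1.
  (* From this index on, both [1 < n] and [L0 <= ln n] hold. *)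
  pose N := maxn 2 (Num.bound (expR L0)).
  have bc n : (N <= n)%N -> c <= b n.
    rewrite geq_max => /andP[n1 nN].
    have np : 0 < n%:R :> R by rewrite ltr0n ltnW.
    have nL : L0 <= ln n%:R.
      rewrite -[L0]expRK ler_ln ?posrE ?expR_gt0 //.
      apply: ltW; apply: lt_le_trans (archi_boundP (expR_ge0 L0)) _.
      by rewrite ler_nat.
    have w0 : 0 < Num.sqrt (ln n%:R / n%:R) :> R.
      by rewrite sqrtr_gt0 divr_gt0 // ln_gt0 // ltr1n.
    rewrite -(ler_pM2r w0) -b_def //; apply: bohr_radius_ge; first exact: ltnW.
      exact: mulr_gt0.
    exact: hL.
  rewrite limn_einf_lim; apply: lime_ge; first exact: is_cvg_einfs.
  exists N => // n /= Nn; apply: le_ereal_inf_tmp => _ [k /= nk <-].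
  by rewrite lee_fin; apply: bc; apply: leq_trans nk.
apply/lee_addgt0Pr => e e0; set q := (Num.sqrt 2)^-1 in qi main *.
(* The cap [q / 2] keeps [q - d] positive, as [main] requires. *)
pose d := Num.min e (q / 2).
have d0 : 0 < d by rewrite lt_min e0 divr_gt0.
have dq : d <= q / 2 by rewrite ge_min lexx orbT.
have de : d <= e by rewrite ge_min lexx.
apply: (@le_trans _ _ ((q - d)%:E + e%:E)%E).
  by rewrite -EFinD lee_fin; lra.
by apply: leeD2r; apply: main; lra.
Qed.
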